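(* Let $\varphi$ be a Musielak–Orlicz function. Then for every $r\in(0,1]$, $P_\varphi(\Omega)=H^{\varphi,\infty,M}_{\mathrm{at},r}(\Omega)$ and $Q_\varphi(\Omega)=H^{\varphi,\infty,S}_{\mathrm{at},r}(\Omega)$ with equivalent quasi-norms.
   Context: Let $(\Omega,\mathcal F,\mathbb P)$ be a probability space, $(\mathcal F_n)_{n\in\mathbb Z_+}$ a nondecreasing sequence of sub-$\sigma$-algebras, $\mathbb E_n$ the conditional expectations. A Musielak–Orlicz function is $\varphi:\Omega\times[0,\infty)\to[0,\infty)$ with $\varphi(x,\cdot)$ nondecreasing, $\varphi(x,0)=0$, $\lim_{t\to\infty}\varphi(x,t)=\infty$ for each $x$, $\varphi(\cdot,t)$ measurable for each $t$; $\|f\|_{L^\varphi(\Omega)}:=\inf\{\lambda>0:\int_\Omega\varphi(x,|f|/\lambda)\,d\mathbb P\le1\}$. $\mathcal M$ is the set of martingales $f=(f_n)_{n\in\mathbb Z_+}$ with $f_0=0$; $d_nf:=f_n-f_{n-1}$, $S_n(f):=(\sum_{i=1}^n|d_if|^2)^{1/2}$, $S(f):=(\sum_{i\ge1}|d_if|^2)^{1/2}$, and for a function or martingale $M(a):=\sup_n|\mathbb E_na|$ (resp. $\sup_n|f_n|$). $\Lambda$ is the set of nondecreasing nonnegative adapted sequences $(\lambda_n)_{n\in\mathbb Z_+}$, $\lambda_\infty:=\lim_n\lambda_n$. $\|f\|_{P_\varphi}:=\inf\|\lambda_\infty\|_{L^\varphi}$ over $(\lambda_n)\in\Lambda$ with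 $|f_n|\le\lambda_{n-1}$ for all $n\ge1$; $\|f\|_{Q_\varphi}:=\inf\|\lambda_\infty\|_{L^\varphi}$ over $(\lambda_n)\in\Lambda$ with $S_n(f)\le\lambda_{n-1}$ for all $n\ge1$; $P_\varphi(\Omega)$, $Q_\varphi(\Omega)$ are the sets of $f\in\mathcal M$ with finite quasi-norm. For a stopping time $\nu$, $B_\nu:=\{\nu<\infty\}$. For $T\in\{S,M\}$, a measurable $a$ is a $(\varphi,\infty)_T$-atom if there is a stopping time $\nu$ with (i) $\mathbb E_na=0$ whenever $\nu\ge n$, (ii) $\|T(a)\|_{L^\infty(B_\nu)}\le\|\mathbf 1_{B_\nu}\|_{L^\varphi(\Omega)}^{-1}$ (where $S(a)$, $M(a)$ are computed for the martingale $(\mathbb E_na)_n$). For $r>0$, $H^{\varphi,\infty,T}_{\mathrm{at},r}(\Omega)$ is the set of $f\in\mathcal M$ for which there exist $\mu^k\ge0$ and $(\varphi,\infty)_T$-atoms $a^k$ with stopping times $\nu^k$ ($k\in\mathbb Z$) such that $f_n=\sum_k\mu^k\mathbb E_na^k$ for all $n$ and $\|\{\sum_k[\mu^k\mathbf 1_{B_{\nu^k}}/\|\mathbf 1_{B_{\nu^k}}\|_{L^\varphi}]^r\}^{1/r}\|_{L^\varphi(\Omega)}<\infty$; its quasi-norm is the infimum of this quantity over all such decompositions. *)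

(* Defs.v *)
From HB Require Import structures.
From mathcomp Require Import all_boot all_order all_algebra.
From mathcomp Require Import all_classical all_reals all_analysis.
Import Order.TTheory GRing.Theory Num.Theory.
Import numFieldNormedType.Exports.
Set Implicit Arguments. Unset Strict Implicit. Unset Printing Implicit Defensive.
Local Open Scope classical_set_scope.
Local Open Scope ring_scope.

Section defs.
Context {R : realType} {d : measure_display} {T : measurableType d}.

(** Musielak--Orlicz function phi : Omega x [0,oo) -> [0,oo)
    (only its values at t >= 0 are ever used). *)
Definition MO_function (phi : T -> R -> R) : Prop :=
  [/\ (forall x s t, 0 <= s -> s <= t -> phi x s <= phi x t),
      (forall x, phi x 0 = 0),
      (forall x t, 0 <= t -> 0 <= phi x t),
      (forall x, phi x @ +oo --> +oo) &
      (forall t, 0 <= t -> measurable_fun setT (fun x => phi x t))].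

(** Luxemburg (quasi-)norm ||g||_{L^phi} of an extended-real function,
    with the convention phi(x, oo) = oo; valued in [0, +oo]. *)
Definition lux_norm (P : probability T R) (phi : T -> R -> R)
    (g : T -> \bar R) : \bar R :=
  ereal_inf [set l%:E | l in [set l : R | 0 < l /\
    (\int[P]_x (match g x with
                | r%:E => (phi x (`|r| / l))%:E
                | _ => +oo end) <= 1)%E]].

Definition Gmeasurable (G : set (set T)) (h : T -> R) : Prop :=
  forall B : set R, measurable B -> G (h @^-1` B).

Definition filtration (F : nat -> set (set T)) : Prop :=
  [/\ (forall n, sigma_algebra setT (F n)),
      (forall n, F n `<=` measurable) &
      (forall n, F n `<=` F n.+1)].

Definition is_condexp (P : probability T R) (G : set (set T)) (h g : T -> R) :=
  [/\ Gmeasurable G g, P.-integrable setT (EFin \o g) &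
      forall A, G A -> (\int[P]_(x in A) (g x)%:E = \int[P]_(x in A) (h x)%:E)%E].

Definition condexps (P : probability T R) (F : nat -> set (set T))
    (E : nat -> (T -> R) -> T -> R) : Prop :=
  forall n h, P.-integrable setT (EFin \o h) -> is_condexp P (F n) h (E n h).

Definition martingale0 (P : probability T R) (F : nat -> set (set T))
    (f : nat -> T -> R) : Prop :=
  [/\ (forall n, Gmeasurable (F n) (f n)),
      (forall n, P.-integrable setT (EFin \o f n)),
      (forall n A, F n A ->
         (\int[P]_(x in A) (f n.+1 x)%:E = \int[P]_(x in A) (f n x)%:E)%E) &
      {ae P, forall x, f 0%N x = 0}].

Definition Sn (f : nat -> T -> R) (n : nat) (x : T) : R :=
  Num.sqrt (\sum_(1 <= i < n.+1) (f i x - f i.-1 x) ^+ 2).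

Definition Sq (f : nat -> T -> R) (x : T) : \bar R :=
  poweR (\sum_(1 <= i <oo) (((f i x - f i.-1 x) ^+ 2)%:E))%E (2^-1).

Definition Mx (f : nat -> T -> R) (x : T) : \bar R :=
  ereal_sup (range (fun n => (`|f n x|)%:E)).

Definition Lambda (F : nat -> set (set T)) (l : nat -> T -> R) : Prop :=
  [/\ (forall n, Gmeasurable (F n) (l n)),
      (forall n x, 0 <= l n x) &
      (forall n x, l n x <= l n.+1 x)].

(** lambda_infty = lim_n lambda_n (= sup_n, possibly +oo) *)
Definition linf (l : nat -> T -> R) (x : T) : \bar R :=
  ereal_sup (range (fun n => (l n x)%:E)).

Definition P_norm (P : probability T R) (F : nat -> set (set T))
    (phi : T -> R -> R) (f : nat -> T -> R) : \bar R :=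
  ereal_inf [set lux_norm P phi (linf l) | l in [set l | Lambda F l /\
     forall n, (0 < n)%N -> {ae P, forall x, `|f n x| <= l n.-1 x}]].

Definition Q_norm (P : probability T R) (F : nat -> set (set T))
    (phi : T -> R -> R) (f : nat -> T -> R) : \bar R :=
  ereal_inf [set lux_norm P phi (linf l) | l in [set l | Lambda F l /\
     forall n, (0 < n)%N -> {ae P, forall x, Sn f n x <= l n.-1 x}]].

(** stopping times, valued in nat U {oo}; None stands for oo *)
Definition stopping_time (F : nat -> set (set T)) (nu : T -> option nat) :=
  forall n : nat, F n [set x | nu x = Some n].

Definition Bnu (nu : T -> option nat) : set T := [set x | nu x <> None].

Definition nu_ge (nu : T -> option nat) (n : nat) (x : T) : bool :=
  if nu x is Some m then (n <= m)%N else true.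

(** (phi, oo)_Top-atom a associated with the stopping time nu;
    Top is S (= Sq) or M (= Mx) applied to the martingale (E_n a)_n *)
Definition atom (P : probability T R) (F : nat -> set (set T))
    (E : nat -> (T -> R) -> T -> R) (phi : T -> R -> R)
    (Top : (nat -> T -> R) -> T -> \bar R)
    (a : T -> R) (nu : T -> option nat) : Prop :=
  [/\ P.-integrable setT (EFin \o a),
      stopping_time F nu,
      (forall n, {ae P, forall x, nu_ge nu n x -> E n a x = 0}) &
      {ae P, forall x, Bnu nu x ->
         (Top (fun n => E n a) x <=
            (lux_norm P phi (EFin \o \1_(Bnu nu)))^-1)%E}].

(** the function (sum_{k in Z} [mu^k 1_{B_k} / ||1_{B_k}||]^r)^(1/r);
    the integers are enumerated as Posz i (= i) and Negz i (= -(i+1)) *)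
Definition at_fun (P : probability T R) (phi : T -> R -> R) (r : R)
    (mu : int -> R) (nu : int -> T -> option nat) (x : T) : \bar R :=
  let term (k : int) : \bar R :=
    poweR ((mu k * \1_(Bnu (nu k)) x)%:E *
           (lux_norm P phi (EFin \o \1_(Bnu (nu k))))^-1)%E r in
  poweR (\sum_(0 <= i <oo) (term (Posz i) + term (Negz i)))%E r^-1.

Definition seq_cvg_to (u : nat -> R) (l : R) : Prop := u @ \oo --> l.

(** atomic quasi-norm (+oo if f admits no atomic decomposition);
    f_n = sum_{k in Z} mu^k E_n a^k, the series converging a.e. *)
Definition at_norm (P : probability T R) (F : nat -> set (set T))
    (E : nat -> (T -> R) -> T -> R) (phi : T -> R -> R)
    (Top : (nat -> T -> R) -> T -> \bar R) (r : R)
    (f : nat -> T -> R) : \bar R :=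
  ereal_inf [set q | exists (mu : int -> R) (a : int -> T -> R)
                            (nu : int -> T -> option nat),
    [/\ (forall k, 0 <= mu k),
        (forall k, atom P F E phi Top (a k) (nu k)),
        (forall n, {ae P, forall x,
           seq_cvg_to (fun N : nat => \sum_(0 <= i < N)
               (mu (Posz i) * E n (a (Posz i)) x +
                mu (Negz i) * E n (a (Negz i)) x)) (f n x)}) &
        q = lux_norm P phi (at_fun P phi r mu nu)]].

End defs.

(* Main.v *)
(* Both equivalences are instances of one argument about a functional [N] of
   real sequences that is either [N_n(u) = |u_n|] (for [P], [M]) or
   [N_n(u) = S_n(u)] (for [Q], [S]).

   Atoms to majorants: if [f = sum_k mu_k a^k], then [E_n a^k] vanishes where
   [nu_k >= n] and is controlled by [1 / ||1_{B_k}||] on [B_k], so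
   [lambda_n = sum_k mu_k 1_{nu_k <= n} / ||1_{B_k}||] majorizes [f]; since
   [r <= 1], its limit is at most the function whose norm defines the atomic norm.

   Majorants to atoms: stop [f] at the first passage [nu_k] of [lambda] above
   [2^k].  The martingale [f^{nu_{k+1}} - f^{nu_k}] has bounded increments and, by
   predictability of [lambda], satisfies [N <= 3 * 2^k]; hence it is bounded in
   [L^2] and closed by an integrable function, which is a multiple of an atom.
   The resulting function in the atomic norm is a geometric sum
   [sum_{2^k < lambda_oo} 2^{kr}], comparable with [lambda_oo^r]. *)

Require Import Defs.
From HB Require Import structures.
From mathcomp Require Import all_boot all_order all_algebra.
From mathcomp Require Import all_classical all_reals all_analysis.
From mathcomp Require Import measurable_realfun ring lra zify.
Import Order.TTheory GRing.Theory Num.Theory.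
Import numFieldNormedType.Exports.
Local Open Scope classical_set_scope.
Local Open Scope ring_scope.
Set Implicit Arguments.
Unset Strict Implicit.
Unset Printing Implicit Defensive.

(** * Stopped sequences *)

(** An atom has to be an integrable function whose conditional expectations are the given layer,
    whereas only [N] of the layer is controlled, and a bounded square function gives no pointwise
    bound. Square integrability is what both cases share: [S] controls the sum of squared increments
    at each point, [M] controls the terminal square, and orthogonality of increments turns the
    latter into the former after integration. The increment from [i] to [i + 1] belongs to layer [k]
    exactly when [2 ^ k < l i <= 2 ^ (k + 1)]. This is an event of [F i], so each layer is again a
    martingale, and since [l i] already bounds [N] at time [i + 1], stopping never overshoots. A
    layer is a difference of stopped sequences with bounds [2 * 2 ^ k] and [2 ^ k], hence the factor
    3. Two degeneracies need care: [||1_B||] may vanish, so its inverse may be infinite, and [E n]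
    is only a version of the conditional expectation, so identities hold almost everywhere and are
    gathered over countably many indices. *)

(** As [Negz i] is [-(i + 1)], the first [N] pairs run through the consecutive block of integers
    from [-N] to [N - 1]. *)
Lemma telescope_int (V : comNzRingType) (g : int -> V) (N : nat) :
  \sum_(0 <= i < N) ((g (Posz i + 1) - g (Posz i)) + (g (Negz i + 1) - g (Negz i)))
  = g N%:Z - g (- N%:Z).
Proof.
elim: N => [|N IH]; first by rewrite big_geq// subrr.
rewrite big_nat_recr//= IH !NegzE.
have -> : (N%:Z + 1 = N.+1%:Z)%R by lia.
have -> : (- N.+1%:Z + 1 = - N%:Z)%R by lia.
ring.
Qed.

(** * Pathwise functionals on real sequences, and stopping *)

Definition Sseq {R : realType} (n : nat) (u : nat -> R) : R :=
  Num.sqrt (\sum_(1 <= i < n.+1) (u i - u i.-1) ^+ 2).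

Definition Mseq {R : realType} (n : nat) (u : nat -> R) : R := `|u n|.

(* [mf_energy]: [S] dominates the energy pathwise, [M] dominates it only through
   the terminal value, i.e. after integration. *)
Record maximal_functional {R : realType} (N : nat -> (nat -> R) -> R) : Prop := {
  mf_add : forall n u v, N n (fun i => u i + v i) <= N n u + N n v ;
  mf_scale : forall n c u, N n (fun i => c * u i) = `|c| * N n u ;
  mf_local : forall n u v, (forall i, (i <= n)%N -> u i = v i) -> N n u = N n v ;
  mf_closed : forall n (U : nat -> nat -> R) v L,
    (forall i, (fun m => U m i) @ \oo --> v i) -> (forall m, N n (U m) <= L) ->
    N n v <= L ;
  mf_stop : forall n m u, (m <= n)%N -> N n (fun i => u (minn i m)) <= N m u ;
  mf_incr : forall n u, `|u n.+1 - u n| <= N n.+1 u + N n u ;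
  mf_energy : (forall n u, Sseq n u <= N n u) \/ (forall n u, `|u n| <= N n u) }.

Section maximal_functional_theory.
Context {R : realType}.
Implicit Types (u v l : nat -> R) (t : R).

(** Minkowski's inequality for the Euclidean norm, by induction on the list: replacing the tails by
    their norms reduces each step to the planar case [two]. *)
Lemma sqrtr_sum_sqr_triangle (I : Type) (s : seq I) (a b : I -> R) :
  Num.sqrt (\sum_(i <- s) (a i + b i) ^+ 2) <=
  Num.sqrt (\sum_(i <- s) a i ^+ 2) + Num.sqrt (\sum_(i <- s) b i ^+ 2).
Proof.
have two (x y z w : R) : 0 <= x -> 0 <= y ->
    Num.sqrt ((x + y) ^+ 2 + (z + w) ^+ 2) <=
    Num.sqrt (x ^+ 2 + z ^+ 2) + Num.sqrt (y ^+ 2 + w ^+ 2).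
  move=> x0 y0; set p := Num.sqrt (x ^+ 2 + _); set q := Num.sqrt (y ^+ 2 + _).
  have p0 : 0 <= p by exact: sqrtr_ge0.
  have q0 : 0 <= q by exact: sqrtr_ge0.
  have p2 : p ^+ 2 = x ^+ 2 + z ^+ 2 by rewrite sqr_sqrtr// addr_ge0// sqr_ge0.
  have q2 : q ^+ 2 = y ^+ 2 + w ^+ 2 by rewrite sqr_sqrtr// addr_ge0// sqr_ge0.
  rewrite -(ler_pXn2r (_ : 0 < 2)%N)// ?nnegrE ?sqrtr_ge0 ?addr_ge0//.
  rewrite sqr_sqrtr ?addr_ge0 ?sqr_ge0//.
  suff : x * y + z * w <= p * q by nra.
  apply: (le_trans (ler_norm _)).
  rewrite -(ler_pXn2r (_ : 0 < 2)%N)// ?nnegrE ?mulr_ge0//.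
  rewrite real_normK ?num_real// exprMn p2 q2.
  (* Lagrange's identity: the product of the two sums of squares exceeds the squared inner product
     by exactly this square. *)
  have := sqr_ge0 (x * w - y * z); nra.
elim: s => [|i s IH]; first by rewrite !big_nil sqrtr0 addr0.
rewrite !big_cons; set A := \sum_(j <- s) (a j + b j) ^+ 2.
set B := \sum_(j <- s) a j ^+ 2; set C := \sum_(j <- s) b j ^+ 2.
have B0 : 0 <= B by apply: sumr_ge0 => j _; exact: sqr_ge0.
have C0 : 0 <= C by apply: sumr_ge0 => j _; exact: sqr_ge0.
have A0 : 0 <= A by apply: sumr_ge0 => j _; exact: sqr_ge0.
have := two (Num.sqrt B) (Num.sqrt C) (a i) (b i) (sqrtr_ge0 _) (sqrtr_ge0 _).
rewrite !sqr_sqrtr// (addrC B) (addrC C) (addrC ((Num.sqrt B + _) ^+ 2)); apply: le_trans.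
rewrite ler_wsqrtr// lerD2l -(sqr_sqrtr A0).
by rewrite ler_pXn2r// nnegrE ?addr_ge0 ?sqrtr_ge0.
Qed.

Lemma Mseq_maximal : maximal_functional (@Mseq R).
Proof.
split.
- by move=> n u v; exact: ler_normD.
- by move=> n c u; exact: normrM.
- by move=> n u v uv; rewrite /Mseq uv.
- by move=> n U v L Uv UL; apply: (cvgr_to_le (cvg_norm (Uv n))); exact: nearW.
- by move=> n m u mn; rewrite /Mseq (minn_idPr mn).
- by move=> n u; exact: ler_normB.
- by right.
Qed.

Lemma Sseq_maximal : maximal_functional (@Sseq R).
Proof.
split.
- move=> n u v; rewrite /Sseq.
  under eq_bigr do rewrite opprD addrACA.
  exact: sqrtr_sum_sqr_triangle.
- move=> n c u; rewrite /Sseq -sqrtr_sqr -sqrtrM ?sqr_ge0// mulr_sumr.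
  by congr Num.sqrt; apply: eq_bigr => i _; rewrite -mulrBr exprMn.
- move=> n u v uv; congr Num.sqrt; apply: eq_big_nat => i /andP[i0 iN].
  by rewrite !uv//; lia.
- move=> n U v L Uv UL.
  suff UvS : (fun m => Sseq n (U m)) @ \oo --> Sseq n v.
    by apply: (cvgr_to_le UvS); exact: nearW.
  have C k : (fun m => \sum_(1 <= i < k) (U m i - U m i.-1) ^+ 2) @ \oo -->
      (\sum_(1 <= i < k) (v i - v i.-1) ^+ 2 : R).
    elim: k => [|k IH].
      by rewrite big_geq//; under eq_fun do rewrite big_geq//; exact: cvg_cst.
    have [k0|k0] := leqP 1 k; last first.
      by rewrite big_geq//; under eq_fun do rewrite big_geq//; exact: cvg_cst.
    rewrite big_nat_recr//=; under eq_fun do rewrite big_nat_recr//=.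
    apply: cvgD => //; rewrite expr2; under eq_fun do rewrite expr2.
    by apply: cvgM; apply: cvgB; exact: Uv.
  exact: (cvg_comp _ _ (C n.+1) (@sqrt_continuous R _)).
- move=> n m u mn; rewrite /Sseq ler_wsqrtr// (@big_cat_nat _ _ _ m.+1)//=.
  rewrite [X in _ + X]big1_seq ?addr0; last first.
    move=> i; rewrite mem_index_iota => /andP[_ /andP[mi _]].
    by rewrite !(minn_idPr _) ?subrr ?expr0n//; lia.
  apply: ler_sum_nat => i /andP[i0 im].
  by rewrite !(minn_idPl _)//; lia.
- move=> n u; rewrite ler_wpDr ?sqrtr_ge0// -sqrtr_sqr ler_wsqrtr//.
  by rewrite big_nat_recr//= lerDr sumr_ge0// => i _; exact: sqr_ge0.
- by left.
Qed.

Section consequences.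
Context (N : nat -> (nat -> R) -> R) (HN : maximal_functional N).

Lemma mf_cst0 n : N n (fun=> 0) = 0.
Proof.
by have := mf_scale HN n 0 (fun=> 0); rewrite normr0 !mul0r.
Qed.

Lemma mf_opp n u : N n (fun i => - u i) = N n u.
Proof.
have := mf_scale HN n (-1) u; rewrite normrN1 mul1r => <-.
by apply: (mf_local HN) => i _; rewrite mulN1r.
Qed.

Lemma mf_ge0 n u : 0 <= N n u.
Proof.
have := mf_add HN n u (fun i => - u i).
rewrite mf_opp (mf_local HN (v := fun=> 0)) ?mf_cst0; first by lra.
by move=> i _; rewrite subrr.
Qed.

End consequences.

(** For nondecreasing [l] and [u 0 = 0] this is [u] stopped at the first index where [l] exceeds
    [t]. Written as a sum of selected increments, two such sequences subtract term by term. *)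
Definition stopped_at t u l (n : nat) : R :=
  \sum_(1 <= i < n.+1) (if l i.-1 <= t then u i - u i.-1 else 0).

Lemma stopped_at_big0 t u l n :
  stopped_at t u l n = \sum_(0 <= i < n) (if l i <= t then u i.+1 - u i else 0).
Proof. by rewrite /stopped_at big_add1. Qed.

(** The witness [m] is the minimum of [n] and the first passage of [l] above [t]; one step before
    [m] the level [t] has not yet been exceeded. *)
Lemma stopped_atE t u l n : {homo l : i j / (i <= j)%N >-> i <= j} -> u 0%N = 0 ->
  exists m, [/\ (m <= n)%N, (0 < m)%N -> l m.-1 <= t &
    forall i, (i <= n)%N -> stopped_at t u l i = u (minn i m)].
Proof.
move=> lnd u0; elim: n => [|n [m [mn lm IH]]].
  exists 0%N; split => // i; rewrite leqn0 => /eqP ->.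
  by rewrite /stopped_at big_geq.
have [ln|ln] := boolP (l n <= t).
  exists n.+1; split => // i iN; rewrite (minn_idPl iN) /stopped_at.
  rewrite (@telescope_sumr_eq _ 1 i.+1 (fun j => u j.-1)) //=.
    by rewrite u0 subr0.
  move=> k /andP[k0 ki]; rewrite ifT// (le_trans (lnd _ n _))//; lia.
exists m; split => //; first exact: leqW.
move=> i; rewrite leq_eqVlt => /orP[/eqP ->|]; last exact: IH.
rewrite {1}/stopped_at big_nat_recr//= (negPf ln) addr0 -/(stopped_at _ _ _ n).
by rewrite IH// !(minn_idPr _)//; lia.
Qed.

Section stopped_bounds.
Context (N : nat -> (nat -> R) -> R) (HN : maximal_functional N).
Context (u l : nat -> R) (lnd : {homo l : i j / (i <= j)%N >-> i <= j})
  (u0 : u 0%N = 0) (ul : forall n, (0 < n)%N -> N n u <= l n.-1).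

Lemma mf_start : N 0%N u = 0.
Proof.
rewrite (mf_local HN (v := fun=> 0)) ?mf_cst0// => i.
by rewrite leqn0 => /eqP ->.
Qed.

(** Predictability rules out an overshoot: at the stopping index [m > 0], [N m u <= l m.-1 <= t]. *)
Lemma mf_stopped_le t n : 0 <= t -> N n (stopped_at t u l) <= t.
Proof.
move=> t0; have [m [mn lm E]] := @stopped_atE t u l n lnd u0.
rewrite (mf_local HN E) (le_trans (mf_stop HN _ mn))//.
have [->|m0] := posnP m; first by rewrite mf_start.
exact: le_trans (ul _) (lm _).
Qed.

(** The two terms of [mf_incr] are at most [l n] and [l n.-1], which gives the factor 2; at [n = 0]
    the second one vanishes. *)
Lemma incr_le n : `|u n.+1 - u n| <= 2 * l n.
Proof.
have := mf_incr HN n u; have := @ul n.+1 isT => /=.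
have [->|n0] := posnP n.
  by rewrite mf_start; have := mf_ge0 HN 1%N u; lra.
have := lnd (leq_pred n); have := ul n0; lra.
Qed.

Lemma stopped_incr_le t i : 0 <= t ->
  `|if l i <= t then u i.+1 - u i else 0| <= 2 * t.
Proof.
move=> t0; case: ifPn => [lt|_]; last by rewrite normr0 mulr_ge0.
by rewrite (le_trans (incr_le i))// ler_pM2l.
Qed.

Lemma stopped_at_le t n : 0 <= t -> `|stopped_at t u l n| <= 2 * t * n%:R.
Proof.
move=> t0; elim: n => [|n IH].
  by rewrite /stopped_at big_geq// normr0 mulr0.
rewrite /stopped_at big_nat_recr//= (le_trans (ler_normD _ _))//.
by rewrite -[n.+1%:R]natr1 mulrDr mulr1 lerD// stopped_incr_le.
Qed.

Lemma stopped_at_large t n : l n <= t -> stopped_at t u l n = u n.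
Proof.
move=> lt; rewrite /stopped_at (@telescope_sumr_eq _ 1 n.+1 (fun j => u j.-1))//=.
  by rewrite u0 subr0.
move=> k /andP[k0 ki]; rewrite ifT// (le_trans _ lt)// lnd//; lia.
Qed.

End stopped_bounds.
End maximal_functional_theory.

(** * The operators [M] and [S] as suprema of the pathwise functionals *)

Section top_spec.
Context {R : realType} {d : measure_display} {T : measurableType d}.

Definition is_sup_of (N : nat -> (nat -> R) -> R)
    (Top : (nat -> T -> R) -> T -> \bar R) :=
  forall f x c, (Top f x <= c)%E <-> forall n, ((N n (f^~ x))%:E <= c)%E.

Lemma Mx_is_sup : is_sup_of Mseq (@Mx R d T).
Proof.
move=> f x c; split => [/ereal_supP h n|h]; first by apply: h; exists n.
by apply/ereal_supP => _ [n _ <-]; exact: h.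
Qed.

Lemma Sq_is_sup : is_sup_of Sseq (@Sq R d T).
Proof.
move=> f x c; set a := fun i => (f i x - f i.-1 x) ^+ 2.
have a0 i : (1 <= i)%N -> true -> (0 <= (a i)%:E)%E by rewrite lee_fin sqr_ge0.
have s0 n : 0 <= \sum_(1 <= i < n.+1) a i by apply: sumr_ge0 => i _; exact: sqr_ge0.
have half : (2^-1 : R) != 0 by rewrite invr_neq0.
have E n : (Sseq n (f^~ x))%:E = poweR (\sum_(1 <= i < n.+1) (a i)%:E)%E (2^-1).
  by rewrite poweR12_sqrt ?sumEFin ?lee_fin// sqrte_fin.
split => [h n|h].
  rewrite E (le_trans _ h)// gt0_ler_poweR ?in_itv/= ?leey ?andbT ?nneseries_ge0//.
  - by rewrite sumEFin lee_fin.
  - exact: nneseries_lim_ge.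
have c0 : (0 <= c)%E by rewrite (le_trans _ (h 0%N))// lee_fin sqrtr_ge0.
case: c h c0 => [c| |] h c0; rewrite ?leey//.
rewrite lee_fin in c0.
have -> : c%:E = poweR (c ^+ 2)%:E (2^-1).
  by rewrite poweR12_sqrt ?lee_fin ?sqr_ge0//= sqrtr_sqr ger0_norm.
rewrite /Sq gt0_ler_poweR ?in_itv/= ?leey ?andbT ?nneseries_ge0 ?lee_fin ?sqr_ge0//.
apply: lime_le; first exact: is_cvg_nneseries.
near=> n; have [n0|n0] := posnP n; first by rewrite n0 big_geq// lee_fin sqr_ge0.
rewrite sumEFin lee_fin -(prednK n0) -(sqr_sqrtr (s0 n.-1)) ler_sqr ?nnegrE ?sqrtr_ge0//.
by have := h n.-1; rewrite lee_fin.
Unshelve. all: by end_near. Qed.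

End top_spec.

(** * Luxemburg norms and power sums *)

Lemma le_mul_ereal_inf {R : realType} (S : set (\bar R)) (C : R) (x : \bar R) :
  0 < C -> (forall y, S y -> (x <= C%:E * y)%E) -> (x <= C%:E * ereal_inf S)%E.
Proof.
move=> C0 h; rewrite -lee_pdivrMl//; apply: le_ereal_inf_tmp => y Sy.
by rewrite lee_pdivrMl//; exact: h.
Qed.

Section luxemburg.
Context {R : realType} {d : measure_display} {T : measurableType d}
  (P : probability T R) (phi : T -> R -> R) (MO : MO_function phi).
Implicit Types (g h : T -> \bar R).

(* No measurability is assumed: the integral of a nonnegative function is a
   supremum over the simple functions below it. *)
Lemma ge0_le_integral_nonmeas g h : (forall x, (0 <= g x)%E) ->
  (forall x, (g x <= h x)%E) -> (\int[P]_x g x <= \int[P]_x h x)%E.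
Proof.
move=> g0 gh; rewrite !ge0_integralTE//; last first.
  by move=> x; exact: le_trans (gh x).
apply: ereal_sup_le => _ [k /= kg <-]; exists k => //= x.
exact: le_trans (kg x) (gh x).
Qed.

Lemma MO_ge0 x t : 0 <= t -> 0 <= phi x t.
Proof. by case: MO => _ _ + _ _; exact. Qed.

Lemma MO_le x s t : 0 <= s -> s <= t -> phi x s <= phi x t.
Proof. by case: MO => + _ _ _ _; exact. Qed.

Definition lux_integrand g (l : R) (x : T) : \bar R :=
  match g x with r%:E => (phi x (`|r| / l))%:E | _ => +oo%E end.

Lemma lux_integrand_ge0 g l x : 0 < l -> (0 <= lux_integrand g l x)%E.
Proof.
move=> l0; rewrite /lux_integrand; case: (g x) => [r| |]; rewrite ?leey//.
by rewrite lee_fin MO_ge0// divr_ge0// ltW.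
Qed.

Lemma lux_norm_ge0 g : (0 <= lux_norm P phi g)%E.
Proof. by apply: le_ereal_inf_tmp => _ [l [/ltW l0 _] <-]; rewrite lee_fin. Qed.

(** If the level [l] is admissible for [h], then [C * l] is admissible for [g], because [phi x] is
    nondecreasing. *)
Lemma lux_norm_le_scale (C : R) g h : 0 < C -> (forall x, (0 <= g x)%E) ->
  (forall x, (g x <= C%:E * h x)%E) ->
  (lux_norm P phi g <= C%:E * lux_norm P phi h)%E.
Proof.
move=> C0 g0 gh; apply: le_mul_ereal_inf => // _ [l [l0 hl] <-].
apply: ge_ereal_inf; exists (C * l)%:E; last by rewrite EFinM.
exists (C * l) => //; split; first exact: mulr_gt0.
apply: le_trans hl; apply: ge0_le_integral_nonmeas => x.
  by apply: lux_integrand_ge0; exact: mulr_gt0.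
have := gh x; have := g0 x.
case: (h x) => [s| |]; case: (g x) => [r| |]; rewrite ?leey//.
rewrite -EFinM !lee_fin => r0 rs; apply: MO_le.
  by rewrite divr_ge0// ltW// mulr_gt0.
rewrite ger0_norm// ler_pdivrMr ?mulr_gt0// mulrCA -mulrA mulVf ?gt_eqF// mulr1.
by rewrite (le_trans rs)// ler_pM2l// ler_norm.
Qed.

(** At any admissible level the integrand is infinite on [D], while its integral is at most 1. *)
Lemma lux_norm_fin_negligible g (D : set T) : measurable D ->
  (lux_norm P phi g < +oo)%E -> (forall x, D x -> g x = +oo%E) -> P D = 0%E.
Proof.
move=> mD /ereal_inf_lt [_ [l [l0 gl] <-] _] gD.
have PD : (+oo * P D <= 1)%E.
  rewrite -integral_cst// integral_mkcond (le_trans _ gl)//.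
  apply: ge0_le_integral_nonmeas => x; rewrite patchE; case: ifPn => // xD.
  - exact: leey.
  - by rewrite gD ?leey//; exact/set_mem.
  exact: lux_integrand_ge0.
apply/eqP; rewrite eq_le measure_ge0 andbT leNgt; apply/negP => D0.
by move: PD; rewrite gt0_mulye// leye_eq.
Qed.

(** A zero norm makes every level admissible, so the integral of [phi x n.+1%:R] over [B] is at most
    1 for all [n]. Since [phi x] tends to infinity, monotone convergence leaves no mass on [B]. *)
Lemma lux_norm_indic_eq0 (B : set T) : measurable B ->
  lux_norm P phi (EFin \o \1_B) = 0%E -> P B = 0%E.
Proof.
move=> mB B0; have [_ phi0 _ phioo mphi] := MO.
pose g n x := (phi x n.+1%:R)%:E.
have g1 n : (\int[P]_(x in B) g n x <= 1)%E.
  have : (lux_norm P phi (EFin \o \1_B) < n.+1%:R^-1%:E)%E.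
    by rewrite B0 lte_fin invr_gt0.
  move=> /ereal_inf_lt [_ [l [l0 gl] <-]]; rewrite lte_fin => ln.
  rewrite integral_mkcond (le_trans _ gl)//.
  apply: ge0_le_integral_nonmeas => x; rewrite patchE; case: ifPn => xB //=.
  - by rewrite lee_fin MO_ge0.
  - rewrite lee_fin MO_le// indicE xB normr1 div1r.
    by rewrite -[leLHS]invrK lef_pV2 ?posrE ?invr_gt0// ltW.
  - by rewrite lee_fin MO_ge0// divr_ge0// ltW.
have mg n : measurable_fun B (g n).
  by apply/measurable_EFinP; apply: measurable_funTS; exact: mphi.
have g0 n x : B x -> (0 <= g n x)%E by rewrite lee_fin MO_ge0.
have nd x : B x -> {homo (g ^~ x) : n m / (n <= m)%N >-> (n <= m)%E}.
  by move=> _ n m nm; rewrite lee_fin MO_le// ler_nat.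
have lg x : limn (g ^~ x) = +oo%E.
  apply/cvg_lim => //; apply/cvgeryP.
  apply: (cvg_comp (fun n : nat => n.+1%:R : R) (phi x)) (phioo x).
  by rewrite (cvg_shiftS (fun n => n%:R : R)); exact: cvgr_idn.
have := monotone_convergence P mB mg g0 nd.
under eq_integral do rewrite lg.
rewrite integral_cst// => E.
have : (+oo * P B <= 1)%E.
  rewrite E; apply: lime_le; last exact: nearW.
  apply: ereal_nondecreasing_is_cvgn => n m nm.
  by apply: ge0_le_integral => // x Bx; [exact: g0|exact: nd].
move=> PB; apply/eqP; rewrite eq_le measure_ge0 andbT leNgt; apply/negP => D0.
by move: PB; rewrite gt0_mulye// leye_eq.
Qed.

End luxemburg.

(** * Geometric sums over dyadic levels, and power sums *)

Section power_sums.
Context {R : realType}.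

(** The 3 comes from the bound [3 * 2 ^ k] on a layer; the other factor is the [r]-th root of the
    geometric series of ratio [2 ^ (-r)]. *)
Definition atomic_constant (r : R) : R := 3 * (1 - 2 `^ (- r))^-1 `^ r^-1.

Lemma one_sub_powR_gt0 (r : R) : 0 < r -> 0 < 1 - (2 : R) `^ (- r).
Proof.
move=> r0; have : 1 `^ r < (2 : R) `^ r by apply: gt0_ltr_powR; rewrite ?nnegrE//; lra.
by rewrite powR1 subr_gt0 powRN invf_lt1 ?powR_gt0.
Qed.

Lemma atomic_constant_gt0 r : 0 < r -> 0 < atomic_constant r.
Proof.
by move=> r0; rewrite mulr_gt0// powR_gt0// invr_gt0 one_sub_powR_gt0.
Qed.

Definition dyadic_layer (r L : R) (k : int) : R :=
  if 2 ^ k < L then (2 ^ k) `^ r else 0.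

Lemma dyadic_sum_le (r L : R) (N : nat) : 0 < r -> 0 <= L ->
  \sum_(0 <= i < N) (dyadic_layer r L (Posz i) + dyadic_layer r L (Negz i)) <=
  L `^ r / (1 - 2 `^ (- r)).
Proof.
move=> r0 L0; set s := dyadic_layer r L; set q := 1 - _.
have q0 : 0 < q by exact: one_sub_powR_gt0.
have t0 (k : int) : 0 < (2 : R) ^ k by exact: exprz_gt0.
have tS (k : int) : (2 : R) ^ k = 2 * 2 ^ (k - 1).
  by rewrite -{1}(subrK 1 k) expfzDr// expr1z mulrC.
have t1 (k : int) : (2 : R) ^ (k - 1) <= 2 ^ k.
  by rewrite (tS k); have := t0 (k - 1); lra.
(* This turns the geometric sum into a telescoping one. When [2 ^ k < L], the increment of [g] at
   [k] is [2 ^ (k r) - 2 ^ ((k - 1) r)], that is [s k * q]; otherwise [s k] is 0 and monotonicity of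
   [g] suffices. *)
pose g (k : int) := Num.min L (2 ^ (k - 1)) `^ r.
have gm0 k : 0 <= Num.min L (2 ^ k) by rewrite le_min L0 ltW.
have gle k : g k <= L `^ r.
  by apply: ge0_ler_powR; rewrite ?nnegrE ?ge_min ?lexx//; exact: ltW.
have sg k : s k * q <= g (k + 1) - g k.
  rewrite /s /dyadic_layer /g addrK; case: ifPn => [kL|_]; last first.
    rewrite mul0r subr_ge0; apply: ge0_ler_powR; rewrite ?nnegrE//.
      exact: ltW.
    by rewrite le_min !ge_min lexx/= t1 orbT.
  have -> : Num.min L (2 ^ k) = 2 ^ k by apply/min_idPr/ltW.
  have -> : Num.min L (2 ^ (k - 1)) = 2 ^ (k - 1).
    by apply/min_idPr; exact: le_trans (ltW kL).
  rewrite /q mulrBr mulr1 lerD2l lerN2 (tS k) powRM ?(ltW (t0 _))//.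
  by rewrite mulrAC -powRD ?subrr ?powRr0 ?mul1r// pnatr_eq0 implybT.
rewrite ler_pdivlMr// mulr_suml.
apply: (@le_trans _ _ (\sum_(0 <= i < N) ((g (Posz i + 1) - g (Posz i)) +
    (g (Negz i + 1) - g (Negz i))))).
  by apply: ler_sum => i _; rewrite mulrDl lerD.
by rewrite telescope_int (le_trans _ (gle N))// gerBl powR_ge0.
Qed.

Local Open Scope ereal_scope.

Lemma nneseries_pair_partial (c : int -> \bar R) (N : nat) :
  (forall k, 0 <= c k) ->
  \sum_(0 <= i < N) (c (Posz i) + c (Negz i)) <=
  \sum_(0 <= i <oo) (c (Posz i) + c (Negz i)).
Proof. by move=> c0; apply: nneseries_lim_ge => i _ _; exact: adde_ge0. Qed.

Lemma le_nneseries_pair (c : int -> \bar R) k : (forall k, 0 <= c k) ->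
  c k <= \sum_(0 <= i <oo) (c (Posz i) + c (Negz i)).
Proof.
move=> c0; have c1 i : 0 <= c (Posz i) + c (Negz i) by exact: adde_ge0.
case: k => n; apply: le_trans (nneseries_pair_partial n.+1 c0);
  rewrite big_nat_recr//=; apply: (@le_trans _ _ (c (Posz n) + c (Negz n)));
  by rewrite ?leeDl ?leeDr ?sume_ge0.
Qed.

(* [c_k = c_k ^ r * c_k ^ (1 - r) <= c_k ^ r * A ^ (1 - r)] where [A] is the
   right-hand side. *)
Lemma sum_le_power_sum (c : int -> \bar R) (r : R) : (0 < r <= 1)%R ->
  (forall k, 0 <= c k) ->
  \sum_(0 <= i <oo) (c (Posz i) + c (Negz i)) <=
  poweR (\sum_(0 <= i <oo) (poweR (c (Posz i)) r + poweR (c (Negz i)) r)) r^-1.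
Proof.
move=> /andP[r0 r1] c0; set S := (X in poweR X r^-1); set A := poweR S r^-1.
have cr0 k : 0 <= poweR (c k) r by exact: poweR_ge0.
have S0 : 0 <= S by apply: nneseries_ge0 => i _ _; exact: adde_ge0.
have rn0 : r != 0%R by rewrite gt_eqF.
have AS : poweR A r = S by rewrite -poweRrM mulVf// poweRe1.
have A0 : 0 <= A by exact: poweR_ge0.
have cA k : c k <= A.
  rewrite -(poweRe1 (c0 k)) -(mulfV rn0) poweRrM.
  apply: gt0_ler_poweR; rewrite ?invr_ge0 ?in_itv/= ?leey ?andbT//.
    exact: ltW.
  exact: (@le_nneseries_pair (fun k => poweR (c k) r)).
clearbody A; case: A AS A0 cA => [a| |] AS A0 cA; rewrite ?leey//.
rewrite lee_fin in A0.
have cfin k : c k \is a fin_num.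
  by rewrite ge0_fin_numE// (le_lt_trans (cA k))// ltry.
have ck k : c k <= (a `^ (1 - r))%:E * poweR (c k) r.
  have := cA k; have := c0 k; rewrite -(fineK (cfin k)) poweR_EFin !lee_fin.
  move: (fine _) => x x0 xa.
  have [->|xn0] := eqVneq x 0%R; first by rewrite mulr_ge0// powR_ge0.
  rewrite -[leLHS]powRr1// -{1}(subrK r 1%R) powRD ?xn0 ?implybT//.
  by rewrite ler_wpM2r ?powR_ge0// ge0_ler_powR ?nnegrE ?subr_ge0.
apply: lime_le; first by apply: is_cvg_nneseries => i _ _; exact: adde_ge0.
apply: nearW => n.
apply: (@le_trans _ _ ((a `^ (1 - r))%:E * S)); last first.
  rewrite -AS poweR_EFin -EFinM lee_fin.
  have [->|an0] := eqVneq a 0%R; first by rewrite (powR0 rn0) mulr0.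
  by rewrite -powRD ?an0 ?implybT// subrK powRr1.
apply: (@le_trans _ _ ((a `^ (1 - r))%:E *
   \sum_(0 <= i < n) (poweR (c (Posz i)) r + poweR (c (Negz i)) r))); last first.
  rewrite lee_wpmul2l ?lee_fin ?powR_ge0//.
  exact: (@nneseries_pair_partial (fun k => poweR (c k) r)).
rewrite ge0_sume_distrr; last by move=> i _; exact: adde_ge0.
by apply: lee_sum => i _; rewrite ge0_muleDr//; exact: leeD.
Qed.

End power_sums.

(** * Measurability and orthogonality relative to a sub-sigma-algebra *)

Section sub_sigma_algebra_measurability.
Context {R : realType} {d : measure_display} {T : measurableType d}.
Context (G : set (set T)) (sG : sigma_algebra setT G).

(** This lets measurability results for arbitrary measurable types be applied to the members of the
    filtration. *)
Lemma sub_measurableE : G = @measurable _ (g_sigma_algebraType G).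
Proof. by rewrite /measurable/= sigma_algebra_id. Qed.

Lemma GmeasurableP (h : T -> R) :
  Gmeasurable G h <-> measurable_fun (setT : set (g_sigma_algebraType G)) h.
Proof.
split => [hG _ B mB|hG B mB]; first by rewrite setTI -sub_measurableE; exact: hG.
by have := hG measurableT B mB; rewrite setTI -sub_measurableE.
Qed.

Lemma Gmeasurable_le (h : T -> R) t : Gmeasurable G h -> G [set x | h x <= t].
Proof.
by move=> /(_ `]-oo, t]%classic (measurable_itv _)); rewrite preimage_itvNyc.
Qed.

Lemma Gmeasurable_lt (h : T -> R) t : Gmeasurable G h -> G [set x | t < h x].
Proof.
by move=> /(_ `]t, +oo[%classic (measurable_itv _)); rewrite preimage_itvoy.
Qed.

Lemma Gmeasurable_ge (h : T -> R) t : Gmeasurable G h -> G [set x | t <= h x].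
Proof.
by move=> /(_ `[t, +oo[%classic (measurable_itv _)); rewrite preimage_itvcy.
Qed.

Lemma Gmeasurable_indic (A : set T) : G A -> Gmeasurable G (\1_A : T -> R).
Proof.
by rewrite {1}sub_measurableE => GA; apply/GmeasurableP; exact: measurable_indic.
Qed.

Lemma Gmeasurable_measurable (h : T -> R) :
  G `<=` measurable -> Gmeasurable G h -> measurable_fun setT h.
Proof. by move=> Gm hG _ B mB; rewrite setTI; apply: Gm; exact: hG. Qed.

End sub_sigma_algebra_measurability.

Section integration.
Context {R : realType} {d : measure_display} {T : measurableType d}
  (P : probability T R).

Lemma bounded_integrable (h : T -> R) (c : R) : measurable_fun setT h ->
  (forall x, `|h x| <= c) -> P.-integrable setT (EFin \o h).
Proof.
move=> mh hc; apply: measurable_bounded_integrable => //.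
  by rewrite ltey_eq fin_num_measure.
exists c; split; first exact: num_real.
by move=> M cM x _ /=; rewrite (le_trans (hc x))// ltW.
Qed.

Lemma EFin_Rintegral (h : T -> R) A : measurable A ->
  P.-integrable A (EFin \o h) ->
  (\int[P]_(x in A) h x)%:E = (\int[P]_(x in A) (h x)%:E)%E.
Proof. by move=> mA ih; rewrite fineK// integrable_fin_num. Qed.

Lemma integrable_norm (h : T -> R) : P.-integrable setT (EFin \o h) ->
  P.-integrable setT (EFin \o (fun x => `|h x|)).
Proof. by move=> ih; exact: (integrable_abse ih). Qed.

Lemma integrable_sumR (I : Type) (s : seq I) (f : I -> T -> R) :
  (forall i, P.-integrable setT (EFin \o f i)) ->
  P.-integrable setT (EFin \o (fun x => \sum_(i <- s) f i x)).
Proof.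
move=> fi; rewrite (_ : _ \o _ = fun x => (\sum_(i <- s) (EFin \o f i) x)%E).
  by apply: integrable_sum => // i _; exact: fi.
by apply/funext => x /=; rewrite sumEFin.
Qed.

Lemma Rintegral_sum (I : Type) (s : seq I) (f : I -> T -> R) :
  (forall i, P.-integrable setT (EFin \o f i)) ->
  \int[P]_x (\sum_(i <- s) f i x) = \sum_(i <- s) \int[P]_x f i x.
Proof.
move=> fi; elim: s => [|i s IH].
  under eq_Rintegral do rewrite big_nil.
  by rewrite Rintegral_cst// mul0r big_nil.
under eq_Rintegral do rewrite big_cons.
by rewrite RintegralD ?big_cons ?IH//; exact: integrable_sumR.
Qed.

Lemma Rintegral_indicM (h : T -> R) A :
  \int[P]_x (\1_A x * h x) = \int[P]_(x in A) h x.
Proof.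
rewrite [RHS]Rintegral_mkcond patch_indic; congr fine.
by apply: eq_integral => x _ /=; rewrite mulrC.
Qed.

Lemma Rintegral_ae_le (h : T -> R) (b K : R) : measurable_fun setT h ->
  (forall x, 0 <= h x) -> (forall x, `|h x| <= b) -> {ae P, forall x, h x <= K} ->
  \int[P]_x h x <= K.
Proof.
move=> mh h0 hb hK.
have ih := bounded_integrable mh hb.
rewrite -lee_fin EFin_Rintegral//.
have <- : (\int[P]_x (K%:E) = K%:E)%E.
  by rewrite integral_cst// -[RHS]mule1; congr (_ * _)%E; exact: probability_setT.
(* A negative [K] would contradict [0 <= h] almost everywhere, so the whole space would be null. *)
have K0 : 0 <= K \/ P setT = 0%E.
  have [|K0] := leP 0 K; [by left|right].
  have [A [mA A0 sA]] := hK; apply: (subset_measure0 _ mA) => // x _; apply: sA => /=.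
  by apply/negP; rewrite -ltNge (lt_le_trans K0).
case: K0 => [K0|]; last by rewrite probability_setT => /eqP; rewrite onee_eq0.
apply: ae_ge0_le_integral => //.
- by move=> x _; rewrite lee_fin.
- exact/measurable_EFinP.
- by apply: filterS hK => x hx _; rewrite lee_fin.
Qed.

Lemma measure0_of_integral_eq0 (h : T -> R) A : measurable A -> measurable_fun A h ->
  (forall x, A x -> 0 < h x) -> (\int[P]_(x in A) (h x)%:E = 0)%E -> P A = 0%E.
Proof.
move=> mA mh h0 I0.
have : (\int[P]_(x in A) `|(h x)%:E| = 0)%E.
  rewrite -I0; apply: eq_integral => x /set_mem Ax.
  by rewrite gee0_abs// lee_fin ltW// h0.
move=> /(ae_eq_integral_abs P mA (f := EFin \o h)); case.
  exact/measurable_EFinP.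
move=> N [mN N0 sN]; apply: (subset_measure0 mA mN) => // x Ax; apply: sN => /=.
by move=> /(_ Ax) [] hx; have := h0 x Ax; rewrite hx ltxx.
Qed.

Context (G : set (set T)) (sG : sigma_algebra setT G) (Gm : G `<=` measurable).

(** The set where [h] exceeds [g] lies in [G]; the positive function [h - g] has integral 0 over it,
    so it is null. *)
Lemma Gmeasurable_ae_le (h g : T -> R) : Gmeasurable G h -> Gmeasurable G g ->
  P.-integrable setT (EFin \o h) -> P.-integrable setT (EFin \o g) ->
  (forall A, G A -> (\int[P]_(x in A) (h x)%:E = \int[P]_(x in A) (g x)%:E)%E) ->
  {ae P, forall x, h x <= g x}.
Proof.
move=> mh mg ih ig hg; set A := [set x | 0 < h x - g x].
have GA : G A.
  apply: (@Gmeasurable_lt _ _ _ _ (fun x => h x - g x)).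
  by apply/(GmeasurableP sG); apply: measurable_funB; exact/(GmeasurableP sG).
have mA := Gm GA; exists A; split => //; last by move=> x /= /negP; rewrite -ltNge -subr_gt0.
have iA f : P.-integrable setT f -> P.-integrable A f by exact: integrableS.
apply: (@measure0_of_integral_eq0 (fun x => h x - g x)) => //.
  by apply: measurable_funB; apply: measurable_funTS; exact: (Gmeasurable_measurable Gm).
under eq_integral do rewrite EFinB.
rewrite integralB_EFin//; try exact: iA.
by rewrite hg// subee// integrable_fin_num//; exact: iA.
Qed.

Lemma Gmeasurable_ae_eq (h g : T -> R) : Gmeasurable G h -> Gmeasurable G g ->
  P.-integrable setT (EFin \o h) -> P.-integrable setT (EFin \o g) ->
  (forall A, G A -> (\int[P]_(x in A) (h x)%:E = \int[P]_(x in A) (g x)%:E)%E) ->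
  {ae P, forall x, h x = g x}.
Proof.
move=> mh mg ih ig hg.
have := Gmeasurable_ae_le mh mg ih ig hg.
have := Gmeasurable_ae_le mg mh ig ih (fun A GA => esym (hg A GA)).
by apply: filterS2 => x gh hg'; apply/eqP; rewrite eq_le gh hg'.
Qed.

(** The sum counts the positive multiples of [e] below [y], so it rounds [y] down to a multiple of
    [e]. *)
Lemma staircase_approx (e y : R) (J : nat) : 0 < e -> 0 <= y -> y <= J%:R * e ->
  `|y - \sum_(1 <= j < J.+1) e * (j%:R * e <= y)%R%:R| <= e.
Proof.
move=> e0 y0 yJ; set S := fun n => \sum_(1 <= j < n.+1) e * (j%:R * e <= y)%R%:R.
have H n : [/\ S n <= y, S n <= n%:R * e & S n = n%:R * e \/ y < S n + e].
  elim: n => [|n [Sy Sn Sor]]; first by rewrite /S big_geq// mul0r; split => //; left.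
  rewrite /S big_nat_recr//= -/(S n) -[n.+1%:R]natr1 mulrDl mul1r.
  have [le|lt] := leP (n%:R * e + e) y; rewrite /= ?mulr1 ?mulr0 ?addr0.
    by split; [|by rewrite lerD2r|]; case: Sor => ?; [lra|lra|left; lra|lra].
  by split; [|lra|]; case: Sor => ? //; right; lra.
have [Sy Sn Sor] := H J; rewrite -/(S J).
rewrite ger0_norm ?subr_ge0//; case: Sor; lra.
Qed.

(** By hypothesis [h] is orthogonal to indicators of sets of [G]. The function [g], shifted by [c]
    to be nonnegative, is uniformly within [e] of a staircase on such sets, so the integral is at
    most [e] times that of [|h|]. *)
Lemma orthogonal_bounded (h g : T -> R) (c : R) : P.-integrable setT (EFin \o h) ->
  (forall A, G A -> (\int[P]_(x in A) (h x)%:E = 0)%E) ->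
  Gmeasurable G g -> (forall x, `|g x| <= c) -> \int[P]_x (g x * h x) = 0.
Proof.
move=> ih h0 mg gc.
have mh : measurable_fun setT h by apply/measurable_EFinP; exact: measurable_int ih.
have GT : G setT by rewrite (sub_measurableE sG).
have mg' := Gmeasurable_measurable Gm mg.
have iM (f : T -> R) (c' : R) : measurable_fun setT f -> (forall x, `|f x| <= c') ->
    P.-integrable setT (EFin \o (fun x => f x * h x)).
  move=> mf fc'; apply: (@integrableMr _ _ _ P _ measurableT f (EFin \o h)) => //.
  exists c'; split; first exact: num_real.
  by move=> M cM x _ /=; rewrite (le_trans (fc' x))// ltW.
have c0 : 0 <= c by rewrite (le_trans _ (gc point)).
have Rh0 A : G A -> \int[P]_(x in A) h x = 0 by move=> GA; rewrite /Rintegral h0.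
pose I := \int[P]_x `|h x|.
have I0 : 0 <= I by apply: Rintegral_ge0 => x _.
(* The range of [g + c] lies in [[0, 2c]], which [J] steps of height [(2c + 1) / J] cover; the added
   1 keeps the height positive when [c = 0]. *)
have key (J : nat) : (0 < J)%N -> `|\int[P]_x (g x * h x)| <= ((2 * c + 1) / J%:R) * I.
  move=> J0; set e := _ / J%:R.
  have J0' : 0 < J%:R :> R by rewrite ltr0n.
  have e0 : 0 < e by rewrite divr_gt0//; lra.
  pose A j := [set x | j%:R * e <= g x + c].
  have GA j : G (A j).
    apply: (@Gmeasurable_ge _ _ _ _ (fun x => g x + c)).
    apply/(GmeasurableP sG); apply: measurable_funD; last exact: measurable_cst.
    exact/(GmeasurableP sG).
  pose s x := \sum_(1 <= j < J.+1) e * \1_(A j) x.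
  have sE x : s x = \sum_(1 <= j < J.+1) e * (j%:R * e <= g x + c)%R%:R.
    apply: eq_bigr => j _; rewrite indicE; congr (_ * (nat_of_bool _)%:R).
    by apply/idP/idP => [/set_mem//|?]; exact/mem_set.
  have gs x : `|g x - (s x - c)| <= e.
    rewrite opprB addrA (addrAC (g x)) sE addrAC staircase_approx//.
      by have := gc x; rewrite ler_norml; lra.
    by rewrite /e mulrC divfK ?gt_eqF//; have := gc x; rewrite ler_norml; lra.
  have ms : measurable_fun setT s.
    apply: measurable_sum => j; apply: measurable_funM; first exact: measurable_cst.
    by apply: measurable_indic; apply: Gm; exact: GA.
  have igs : P.-integrable setT (EFin \o (fun x => (g x - (s x - c)) * h x)).
    apply: (iM _ e) => //; apply: measurable_funB => //.
    by apply: measurable_funB => //; exact: measurable_cst.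
  have iA j : P.-integrable setT (EFin \o (fun x => e * (\1_(A j) x * h x))).
    rewrite (_ : (fun x => _) = (fun x => (e * \1_(A j) x) * h x)).
      apply: (iM _ e).
        apply: measurable_funM; first exact: measurable_cst.
        by apply: measurable_indic; apply: Gm; exact: GA.
      move=> x; rewrite normrM gtr0_norm// ger0_norm ?indicE//.
      by rewrite -[leRHS]mulr1 ler_pM2l// lern1; case: (_ \in _).
    by apply/funext => x; rewrite mulrA.
  have iA' j : P.-integrable setT (EFin \o (fun x => \1_(A j) x * h x)).
    apply: (iM _ 1); first by apply: measurable_indic; apply: Gm; exact: GA.
    by move=> x; rewrite ger0_norm indicE// lern1; case: (_ \in _).
  have icst : P.-integrable setT (EFin \o (fun x => - c * h x)).
    by apply: (iM _ c) => // x; rewrite normrN ger0_norm.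
  have isum := integrable_sumR (index_iota 1 J.+1) iA.
  have -> : \int[P]_x (g x * h x) = \int[P]_x ((g x - (s x - c)) * h x).
    transitivity (\int[P]_x ((g x - (s x - c)) * h x +
        ((\sum_(1 <= j < J.+1) e * (\1_(A j) x * h x)) + - c * h x))).
      apply: eq_Rintegral => x _.
      under eq_bigr do rewrite mulrA.
      by rewrite -mulr_suml -/(s x); ring.
    rewrite RintegralD//; last exact: (integrableD measurableT isum icst).
    rewrite RintegralD// RintegralZl// Rh0// mulr0 addr0 Rintegral_sum//.
    rewrite big1 ?addr0// => j _.
    by rewrite RintegralZl// Rintegral_indicM Rh0 ?mulr0.
  rewrite (le_trans (le_normr_Rintegral _ igs))//.
  have iabs : P.-integrable setT (EFin \o (fun x => `|h x|)).
    exact: (integrable_norm ih).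
  rewrite -RintegralZl//; apply: le_Rintegral => //.
  - exact: (integrable_norm igs).
  - exact: (integrableZl measurableT e iabs).
  - by move=> x _; rewrite normrM ler_wpM2r.
apply/eqP; rewrite -normr_eq0; apply/negPn/negP => X0.
set X := `|_| in key X0; have Xgt : 0 < X by rewrite lt_neqAle eq_sym X0 normr_ge0.
set K := (2 * c + 1) * I.
have K0 : 0 <= K / X by rewrite divr_ge0// ?mulr_ge0//; [lra|exact: ltW].
have := key _ (ltn0Sn (Num.bound (K / X))); apply/negP; rewrite -ltNge.
rewrite mulrAC -/K ltr_pdivrMr ?ltr0n// mulrC -ltr_pdivrMr//.
by rewrite (lt_le_trans (archi_boundP K0))// ler_nat.
Qed.

End integration.

(** * Martingales bounded in L2 *)

Lemma filtration_le {T : Type} (F : nat -> set (set T)) m n :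
  (forall n, F n `<=` F n.+1) -> (m <= n)%N -> F m `<=` F n.
Proof.
move=> Finc; elim: n => [|n IH]; first by rewrite leqn0 => /eqP ->.
rewrite leq_eqVlt => /orP[/eqP -> //|mn]; exact: subset_trans (IH mn) (Finc n).
Qed.

Section square_integrable_martingale.
Context {R : realType} {d : measure_display} {T : measurableType d}
  (P : probability T R) (F : nat -> set (set T)) (HF : filtration F).
Context (xi : nat -> T -> R) (c : R)
  (mxi : forall i, Gmeasurable (F i.+1) (xi i))
  (bxi : forall i x, `|xi i x| <= c)
  (oxi : forall i A, F i A -> (\int[P]_(x in A) (xi i x)%:E = 0)%E).

Let sF n : sigma_algebra setT (F n). Proof. by case: HF. Qed.
Let Fm n : F n `<=` measurable. Proof. by case: HF. Qed.
Let Fle m n : (m <= n)%N -> F m `<=` F n.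
Proof. by apply: filtration_le; case: HF. Qed.

Definition psum (n : nat) (x : T) : R := \sum_(0 <= i < n) xi i x.

Lemma psum_Gmeasurable m n : (m <= n)%N -> Gmeasurable (F n) (psum m).
Proof.
move=> mn; apply/(GmeasurableP (sF n)).
elim: m mn => [|m IH] mn.
  rewrite (_ : psum 0 = cst 0); first exact: measurable_cst.
  by apply/funext => x; rewrite /psum big_geq.
rewrite (_ : psum m.+1 = psum m \+ xi m).
  apply: measurable_funD; first by apply: IH; exact: ltnW.
  by apply/(GmeasurableP (sF n)) => B mB; apply: (Fle mn); exact: mxi.
by apply/funext => x; rewrite /psum big_nat_recr.
Qed.

Lemma psum_measurable n : measurable_fun setT (psum n).
Proof.
by apply: (@Gmeasurable_measurable _ _ _ (F n)) => //; exact: psum_Gmeasurable.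
Qed.

Lemma psum_le n x : `|psum n x| <= n%:R * c.
Proof.
rewrite /psum (le_trans (ler_norm_sum _ _ _))//.
rewrite (le_trans (ler_sum _ (fun i _ => bxi i x)))//.
by rewrite big_const_nat iter_addr_0 subn0 mulr_natl.
Qed.

Lemma psum_integrable n : P.-integrable setT (EFin \o psum n).
Proof. exact: (bounded_integrable _ (psum_measurable n) (psum_le n)). Qed.

Lemma xi_measurable i : measurable_fun setT (xi i).
Proof. exact: (Gmeasurable_measurable (@Fm i.+1)). Qed.

Lemma xi_integrable i : P.-integrable setT (EFin \o xi i).
Proof. exact: (bounded_integrable _ (xi_measurable i) (bxi i)). Qed.

Lemma integral_psum m n A : (m <= n)%N -> F m A ->
  (\int[P]_(x in A) (psum n x)%:E = \int[P]_(x in A) (psum m x)%:E)%E.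
Proof.
move=> + FA; elim: n => [|n IH]; first by rewrite leqn0 => /eqP ->.
rewrite leq_eqVlt => /orP[/eqP -> //|]; rewrite ltnS => mn.
have mA := Fm FA.
rewrite -IH// -[RHS]adde0 -(oxi (Fle mn FA)) -integralD_EFin//.
- by apply: eq_integral => x _; rewrite -EFinD /psum big_nat_recr.
- exact: integrableS (psum_integrable n).
- exact: integrableS (xi_integrable n).
Qed.

Lemma sqr_integrable (h : T -> R) b : measurable_fun setT h ->
  (forall x, `|h x| <= b) -> P.-integrable setT (EFin \o (fun x => h x ^+ 2)).
Proof.
move=> mh hb; apply: (@bounded_integrable _ _ _ P _ (b ^+ 2)).
  exact: measurable_funX.
move=> x; rewrite normrX ler_sqr ?nnegrE//.
by rewrite (le_trans _ (hb x)).
Qed.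

(** Pythagoras: the partial sum up to [n] is bounded and [F n]-measurable, hence orthogonal to
    [xi n], and the cross term vanishes. *)
Lemma energy_identity m n : (m <= n)%N ->
  \int[P]_x ((psum n x - psum m x) ^+ 2) = \sum_(m <= i < n) \int[P]_x (xi i x ^+ 2).
Proof.
elim: n => [|n IH].
  rewrite leqn0 => /eqP ->; rewrite big_geq//.
  under eq_Rintegral do rewrite subrr expr0n.
  by rewrite Rintegral_cst// mul0r.
rewrite leq_eqVlt => /orP[/eqP ->|mn].
  rewrite big_geq//; under eq_Rintegral do rewrite subrr expr0n.
  by rewrite Rintegral_cst// mul0r.
rewrite big_nat_recr//= -IH//; set D := fun x => psum n x - psum m x.
have GD : Gmeasurable (F n) D.
  apply/(GmeasurableP (sF n)); apply: measurable_funB; apply/(GmeasurableP (sF n));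
  exact: psum_Gmeasurable.
have bD x : `|D x| <= n%:R * c + m%:R * c.
  by rewrite (le_trans (ler_normB _ _))// lerD// psum_le.
have mD := Gmeasurable_measurable (@Fm n) GD.
have o : \int[P]_x (D x * xi n x) = 0.
  exact: (orthogonal_bounded (sF n) (@Fm n) (xi_integrable n) (@oxi n) GD bD).
have iD2 := sqr_integrable mD bD.
have ix2 := sqr_integrable (xi_measurable n) (bxi n).
have iDx : P.-integrable setT (EFin \o (fun x => D x * xi n x)).
  apply: (@bounded_integrable _ _ _ P _ ((n%:R * c + m%:R * c) * c)).
    by apply: measurable_funM => //; exact: xi_measurable.
  by move=> x; rewrite normrM ler_pM.
have iDx2 := integrableZl measurableT 2 iDx.
transitivity (\int[P]_x (D x ^+ 2 + (2 * (D x * xi n x) + xi n x ^+ 2))).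
  by apply: eq_Rintegral => x _; rewrite /D /psum big_nat_recr//=; ring.
rewrite RintegralD//; last exact: (integrableD measurableT iDx2 ix2).
by rewrite RintegralD// RintegralZl// o mulr0 add0r.
Qed.

Lemma Rintegral_norm_le (h : T -> R) b t : measurable_fun setT h ->
  (forall x, `|h x| <= b) -> 0 < t -> \int[P]_x (h x ^+ 2) <= t ^+ 2 ->
  \int[P]_x `|h x| <= t.
Proof.
move=> mh hb t0 h2.
have ih2 := sqr_integrable mh hb.
have ih := bounded_integrable P mh hb.
have icst : P.-integrable setT (EFin \o (fun=> t / 2)).
  by apply: (@bounded_integrable _ _ _ P _ (`|t / 2|)).
have iq := integrableZl measurableT (2 * t)^-1 ih2.
(* AM-GM: [|h| <= t / 2 + h ^ 2 / (2 * t)] *)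
have /le_trans : \int[P]_x `|h x| <= \int[P]_x (t / 2 + (2 * t)^-1 * h x ^+ 2).
  apply: le_Rintegral => //; first exact: integrable_norm.
    exact: (integrableD measurableT icst iq).
  move=> x _; rewrite -(real_normK (num_real (h x))).
  rewrite -subr_ge0 (_ : _ - _ = (2 * t)^-1 * (t - `|h x|) ^+ 2).
    by rewrite mulr_ge0 ?sqr_ge0// invr_ge0 mulr_ge0// ltW.
  by field; rewrite gt_eqF.
have cst2 : \int[P]_x (t / 2) = t / 2.
  rewrite Rintegral_cst// -[RHS]mulr1; congr (_ * _).
  exact: (congr1 fine (probability_setT P)).
apply; rewrite RintegralD// cst2 RintegralZl//.
rewrite [leRHS](_ : _ = t / 2 + (2 * t)^-1 * t ^+ 2).
  by rewrite lerD2l ler_wpM2l// invr_ge0 mulr_ge0// ltW.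
by field; rewrite gt_eqF.
Qed.

(** The tails are asked to be squares because they bound squared L2 norms; passing to L1 leaves the
    summable [2 ^ (-j)]. *)
Lemma exists_small_tails (e : nat -> R) K : (forall i, 0 <= e i) ->
  (forall n, \sum_(0 <= i < n) e i <= K) ->
  exists N : nat -> nat, [/\ forall j, (N j <= N j.+1)%N, forall j, (j <= N j)%N &
    forall j n, (N j <= n)%N -> \sum_(N j <= i < n) e i <= ((2^-1) ^+ j) ^+ 2].
Proof.
move=> e0 eK; pose s n := \sum_(0 <= i < n) e i.
have hs : has_sup (range s).
  by split; [exists (s 0%N), 0%N|exists K => _ [n _ <-]; exact: eK].
have sd m n : (m <= n)%N -> s n = s m + \sum_(m <= i < n) e i.
  by move=> mn; rewrite /s (@big_cat_nat _ _ _ m).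
have tail0 m n : 0 <= \sum_(m <= i < n) e i by apply: sumr_ge0.
have /choice[N0 HN0] : forall j, exists N,
    sup (range s) - ((2^-1) ^+ j) ^+ 2 < s N.
  move=> j.
  have /(sup_adherent) /(_ hs) [_ [N _ <-] h] : 0 < ((2^-1 : R) ^+ j) ^+ 2.
    by rewrite !exprn_gt0// invr_gt0.
  by exists N.
(* Adding up all earlier thresholds makes the index nondecreasing, at least [j], and at least the
   threshold [N0 j]. *)
exists (fun j => j + \sum_(0 <= i < j.+1) N0 i)%N; split => [j|j|j n jn].
- by rewrite [X in (_ <= _ + X)%N]big_nat_recr//=; lia.
- exact: leq_addr.
- set M := (_ + _)%N in jn *; have NM : (N0 j <= M)%N.
    by rewrite /M big_nat_recr//=; lia.
  have := ub_le_sup hs.2 (ex_intro2 _ _ n I erefl : range s (s n)).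
  have := HN0 j; rewrite (sd _ _ jn) (sd _ _ NM); have := tail0 (N0 j) M; lra.
Qed.

(* The subsequence along which the energy tails are at most [4 ^- j] has
   [L^1]-summable increments, hence converges almost everywhere and dominatedly. *)
Lemma square_integrable_martingale_closed K :
  (forall n, \sum_(0 <= i < n) \int[P]_x (xi i x ^+ 2) <= K) ->
  exists a : T -> R, P.-integrable setT (EFin \o a) /\
    forall n A, F n A ->
      (\int[P]_(x in A) (a x)%:E = \int[P]_(x in A) (psum n x)%:E)%E.
Proof.
move=> HK.
have [|N [Ninc Nge Ntail]] := exists_small_tails _ HK.
  by move=> i; apply: Rintegral_ge0 => x _; exact: sqr_ge0.
pose y j x := psum (N j.+1) x - psum (N j) x.
have my j : measurable_fun setT (y j) by apply: measurable_funB; exact: psum_measurable.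
have by_ j x : `|y j x| <= (N j.+1)%:R * c + (N j)%:R * c.
  by rewrite (le_trans (ler_normB _ _))// lerD// psum_le.
have iy j := bounded_integrable P (my j) (by_ j).
have y1 j : \int[P]_x `|y j x| <= (2^-1) ^+ j.
  apply: (Rintegral_norm_le (my j) (by_ j)); first by rewrite exprn_gt0// invr_gt0.
  by rewrite /y energy_identity// Ntail.
pose G x := (\sum_(0 <= j <oo) (`|y j x|)%:E)%E.
have Gy0 j x : (0 <= (`|y j x|)%:E)%E by rewrite lee_fin.
have G0 x : (0 <= G x)%E by exact: nneseries_ge0.
have mny j : measurable_fun setT (fun x => (`|y j x|)%:E).
  by apply/measurable_EFinP; exact: measurableT_comp.
have mG : measurable_fun setT G by apply: ge0_emeasurable_sum => // k x _ _; exact: Gy0.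
have iG : P.-integrable setT G.
  apply/integrableP; split => //.
  under eq_integral do rewrite gee0_abs//.
  rewrite /G integral_nneseries//.
  apply: (@le_lt_trans _ _ (2%:E)); last exact: ltry.
  apply: lime_le.
    by apply: is_cvg_nneseries => j _ _; apply: integral_ge0 => x _; exact: Gy0.
  apply: nearW => n.
  apply: (@le_trans _ _ (\sum_(0 <= j < n) ((2^-1) ^+ j)%:E)%E).
    apply: lee_sum => j _; rewrite -EFin_Rintegral//; first by rewrite lee_fin.
    exact: (integrable_norm (iy j)).
  rewrite sumEFin lee_fin.
  have -> : \sum_(0 <= j < n) (2^-1) ^+ j = 2 - 2 * (2^-1 : R) ^+ n.
    elim: n => [|n IH]; first by rewrite big_geq// expr0 mulr1 subrr.
    by rewrite big_nat_recr//= IH exprS; field.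
  by rewrite gerBl mulr_ge0// exprn_ge0// invr_ge0.
pose H := [set x | (G x < +oo)%E].
have mH : measurable H.
  rewrite (_ : H = setT `&` G @^-1` (~` [set +oo%E])).
    by apply: mG => //; apply: measurableC; exact: emeasurable_set1.
  by rewrite setTI; apply/seteqP; split => x /=; rewrite /H /= ltey => /eqP.
have aeH : {ae P, forall x, H x}.
  apply: filterS (integrable_ae measurableT iG) => x /(_ I).
  by rewrite ge0_fin_numE.
(* The cut-off gives convergence at every point: on [H] the increments are absolutely summable, off
   [H] the sequence is 0. Integrals do not change, as [H] has full measure. *)
pose f j x := \1_H x * psum (N j) x.
have mf j : measurable_fun setT (f j).
  by apply: measurable_funM; [exact: measurable_indic|exact: psum_measurable].
have psumE j x : psum (N j) x = psum (N 0%N) x + \sum_(0 <= i < j) y i x.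
  elim: j => [|j IH]; first by rewrite big_geq// addr0.
  by rewrite big_nat_recr//= addrA -IH /y addrC subrK.
have fcvg x : cvgn (f ^~ x).
  rewrite /f; have [xH|xH] := boolP (x \in H); last first.
    by rewrite indicE (negPf xH); under eq_fun do rewrite mul0r; exact: is_cvg_cst.
  rewrite indicE xH; under eq_fun do rewrite mul1r psumE.
  apply: is_cvgD; first exact: is_cvg_cst.
  apply: normed_cvg; apply: nnseries_is_cvg; first by move=> i; exact: normr_ge0.
  exact: (set_mem xH).
pose a x := limn (f ^~ x).
have ma : measurable_fun setT a.
  by apply: (measurable_fun_cvg mf) => x _; exact: fcvg.
have dom j x : (`|(f j x)%:E| <= (`|psum (N 0%N) x|)%:E + G x)%E.
  rewrite /f; have [xH|xH] := boolP (x \in H); rewrite indicE ?xH ?(negPf xH).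
    rewrite mul1r psumE (@le_trans _ _ ((`|psum (N 0%N) x|)%:E +
      (\sum_(0 <= i < j) `|y i x|)%:E)%E)//.
      rewrite -EFinD lee_fin (le_trans (ler_normD _ _))// lerD//.
      exact: ler_norm_sum.
    by rewrite leeD// -sumEFin; apply: nneseries_lim_ge => i _ _; exact: Gy0.
  by rewrite mul0r abse0 adde_ge0.
have idom : P.-integrable setT (fun x => (`|psum (N 0%N) x|)%:E + G x)%E.
  by apply: integrableD => //; exact: (integrable_norm (psum_integrable _)).
have DC A : measurable A -> P.-integrable A (EFin \o a) /\
    (fun j => \int[P]_(x in A) (f j x)%:E)%E @ \oo --> (\int[P]_(x in A) (a x)%:E)%E.
  move=> mA.
  have [] := @dominated_convergence _ _ _ P A mA (fun j => EFin \o f j) (EFin \o a)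
    (fun x => (`|psum (N 0%N) x|)%:E + G x)%E.
  - by move=> j; apply/measurable_EFinP; exact: measurable_funTS.
  - by apply/measurable_EFinP; exact: measurable_funTS.
  - by apply/aeW => x _; apply: cvg_EFin; [exact: nearW|exact: fcvg].
  - exact: integrableS idom.
  - by apply/aeW => x n _; exact: dom.
  - by move=> ia _ cv; split.
exists a; split; first by have [] := DC setT measurableT.
move=> n A FA; have mA := Fm FA; have [_ cv] := DC A mA.
apply: (cvg_unique _ cv); first exact: ereal_hausdorff.
(* From [j = n] on, [N j >= n], so by the martingale property the integrals over [A] no longer
   depend on [j]. *)
apply: cvg_near_cst; exists n => // j /= nj.
rewrite -(@integral_psum n (N j) A)//; last exact: leq_trans (Nge j).
apply: ae_eq_integral => //.
- by apply/measurable_EFinP; exact: measurable_funTS.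
- by apply/measurable_EFinP; apply: measurable_funTS; exact: psum_measurable.
- apply: filterS aeH => x Hx _ /=; rewrite /f indicE mem_set//.
  by rewrite mul1r.
Qed.

End square_integrable_martingale.

(** * From atoms to majorants *)

(** Convertible to [P_norm] for [Mseq] and to [Q_norm] for [Sseq], so the final statements need no
    rewriting. *)
Definition majorant_norm {R : realType} {d : measure_display} {T : measurableType d}
    (N : nat -> (nat -> R) -> R) (P : probability T R) (F : nat -> set (set T))
    (phi : T -> R -> R) (f : nat -> T -> R) : \bar R :=
  ereal_inf [set lux_norm P phi (linf l) | l in [set l | Lambda F l /\
     forall n, (0 < n)%N -> {ae P, forall x, N n (f^~ x) <= l n.-1 x}]].

Lemma ae_forall_int {R : realType} {d : measure_display} {T : measurableType d}
    (P : probability T R) (Q : int -> T -> Prop) :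
  (forall k, {ae P, forall x, Q k x}) -> {ae P, forall x k, Q k x}.
Proof.
move=> h.
have h1 := ae_foralln (fun n : nat => h (Posz n)).
have h2 := ae_foralln (fun n : nat => h (Negz n)).
by apply: filterS2 h1 h2 => x q1 q2 [n|n]; [exact: q1|exact: q2].
Qed.

Fixpoint running_max {R : realType} (u : nat -> R) (n : nat) : R :=
  if n is m.+1 then Num.max (running_max u m) (u n) else u 0%N.

Section atomic_to_majorant.
Context {R : realType} {d : measure_display} {T : measurableType d}
  (P : probability T R) (F : nat -> set (set T)) (HF : filtration F)
  (E : nat -> (T -> R) -> T -> R) (phi : T -> R -> R) (MO : MO_function phi)
  (N : nat -> (nat -> R) -> R) (HN : maximal_functional N)
  (Top : (nat -> T -> R) -> T -> \bar R) (HTop : is_sup_of N Top).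

Let sF n : sigma_algebra setT (F n). Proof. by case: HF. Qed.
Let Fm n : F n `<=` measurable. Proof. by case: HF. Qed.
Let Fle m n : (m <= n)%N -> F m `<=` F n.
Proof. by apply: filtration_le; case: HF. Qed.

(** The event is [nu <= n], a finite union of the events [nu = i] with [i <= n]. *)
Lemma stopping_time_le (nu : T -> option nat) n : stopping_time F nu ->
  F n [set x | ~~ nu_ge nu n.+1 x].
Proof.
move=> st; rewrite (_ : [set x | _] = \bigcup_(i in `I_n.+1) [set x | nu x = Some i]).
  rewrite bigcup_mkord (sub_measurableE (sF n)); apply: bigsetU_measurable => i _.
  rewrite -(sub_measurableE (sF n)); apply: (@Fle i n); last exact: st.
  by rewrite -ltnS.
apply/seteqP; split => x /=; rewrite /nu_ge.
  case E1 : (nu x) => [m|//]; rewrite -leqNgt => mn; exists m => //=.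
by move=> [m /= mn ->]; rewrite -leqNgt.
Qed.

Context (r : R) (r01 : 0 < r <= 1) (f : nat -> T -> R)
  (mu : int -> R) (a : int -> T -> R) (nu : int -> T -> option nat)
  (mu0 : forall k, 0 <= mu k)
  (at_a : forall k, atom P F E phi Top (a k) (nu k))
  (cv : forall n, {ae P, forall x,
     seq_cvg_to (fun M : nat => \sum_(0 <= i < M)
       (mu (Posz i) * E n (a (Posz i)) x +
        mu (Negz i) * E n (a (Negz i)) x)) (f n x)})
  (fin : (lux_norm P phi (at_fun P phi r mu nu) < +oo)%E).

(** Infinite when the indicator has zero norm; hence the majorant is first built with extended real
    values. *)
Let w (k : int) : \bar R := (lux_norm P phi (EFin \o \1_(Bnu (nu k))))^-1%E.

Let w0 k : (0 <= w k)%E.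
Proof. by rewrite /w inve_ge0 lux_norm_ge0. Qed.

Let D n k := [set x | ~~ nu_ge (nu k) n.+1 x].

Definition majorant_term (n : nat) (k : int) (x : T) : \bar R :=
  ((mu k * \1_(D n k) x)%:E * w k)%E.

Definition emajorant (n : nat) (x : T) : \bar R :=
  (\sum_(0 <= i <oo) (majorant_term n (Posz i) x + majorant_term n (Negz i) x))%E.

Lemma indic_ge0_le (A B : set T) x : A `<=` B -> (\1_A x : R) <= \1_B x.
Proof.
move=> AB; rewrite !indicE ler_nat; have [|//] := boolP (x \in A).
by move=> /set_mem /AB xB; rewrite mem_set.
Qed.

Lemma majorant_term_ge0 n k x : (0 <= majorant_term n k x)%E.
Proof. by rewrite mule_ge0// lee_fin mulr_ge0// indicE. Qed.

Lemma emajorant_ge0 n x : (0 <= emajorant n x)%E.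
Proof. by apply: nneseries_ge0 => i _ _; rewrite adde_ge0 ?majorant_term_ge0. Qed.

Lemma emajorant_le n x : (emajorant n x <= emajorant n.+1 x)%E.
Proof.
have tle k : (majorant_term n k x <= majorant_term n.+1 k x)%E.
  rewrite lee_wpmul2r// lee_fin ler_wpM2l//; apply: indic_ge0_le => z.
  by rewrite /D /= /nu_ge; case: (nu k z) => // m; rewrite -!leqNgt; exact: leqW.
apply: lee_nneseries => [i _ _|i _].
  by rewrite adde_ge0 ?majorant_term_ge0.
exact: leeD.
Qed.

Lemma emajorant_le_at_fun n x : (emajorant n x <= at_fun P phi r mu nu x)%E.
Proof.
pose C k := ((mu k * \1_(Bnu (nu k)) x)%:E * w k)%E.
have C0 k : (0 <= C k)%E by rewrite mule_ge0// lee_fin mulr_ge0// indicE.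
apply: le_trans (sum_le_power_sum r01 C0).
have tle k : (majorant_term n k x <= C k)%E.
  rewrite lee_wpmul2r// lee_fin ler_wpM2l//; apply: indic_ge0_le => z.
  by rewrite /D /Bnu /= /nu_ge; case: (nu k z).
apply: lee_nneseries => [i _ _|i _].
  by rewrite adde_ge0 ?majorant_term_ge0.
exact: leeD.
Qed.

Lemma emajorant_Gmeasurable n :
  measurable_fun (setT : set (g_sigma_algebraType (F n))) (emajorant n).
Proof.
have mt k : measurable_fun (setT : set (g_sigma_algebraType (F n))) (majorant_term n k).
  apply: emeasurable_funM; last exact: measurable_cst.
  apply/measurable_EFinP; apply: measurable_funM; first exact: measurable_cst.
  apply/(GmeasurableP (sF n)); apply: Gmeasurable_indic => //.
  by apply: stopping_time_le; case: (at_a k).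
apply: ge0_emeasurable_sum => [k x _ _|k _].
  by rewrite adde_ge0 ?majorant_term_ge0.
exact: emeasurable_funD.
Qed.

Lemma emajorant_ae_fin n : {ae P, forall x, (emajorant n x < +oo)%E}.
Proof.
have FD : F n (emajorant n @^-1` [set +oo%E]).
  have := @emajorant_Gmeasurable n measurableT _ (emeasurable_set1 +oo%E).
  by rewrite setTI -sub_measurableE.
exists (emajorant n @^-1` [set +oo%E]); split.
- exact: Fm FD.
- apply: (lux_norm_fin_negligible MO (Fm FD) fin) => x /= Ex.
  by apply/eqP; rewrite -leye_eq -Ex emajorant_le_at_fun.
- by move=> x /= /negP; rewrite -leNgt leye_eq => /eqP.
Qed.

(** [fine] sends an infinite value to 0, which could break monotonicity on the null set where
    [emajorant] becomes infinite; the running maximum restores it and keeps the sequence adapted. *)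
Definition majorant (n : nat) (x : T) : R :=
  running_max (fun m => fine (emajorant m x)) n.

Lemma fine_emajorant_le n x : fine (emajorant n x) <= majorant n x.
Proof. by rewrite /majorant; case: n => //= n; rewrite le_max lexx orbT. Qed.

Lemma majorant_le_emajorant n x : ((majorant n x)%:E <= emajorant n x)%E.
Proof.
have H m : ((fine (emajorant m x))%:E <= emajorant m x)%E.
  by have := emajorant_ge0 m x; case: (emajorant m x) => [s| |] //= _; rewrite leey.
elim: n => [|n IH]; first exact: H.
rewrite /majorant /= EFin_max ge_max H andbT.
exact: le_trans IH (emajorant_le n x).
Qed.

Lemma majorant_Lambda : Lambda F majorant.
Proof.
split.
- move=> n; apply/(GmeasurableP (sF n)).
  have mfine m : (m <= n)%N -> measurable_fun
      (setT : set (g_sigma_algebraType (F n))) (fun x => fine (emajorant m x)).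
    move=> mn; apply/(GmeasurableP (sF n)) => B mB; apply: (Fle mn).
    have : Gmeasurable (F m) (fun x => fine (emajorant m x)).
      apply/(GmeasurableP (sF m)).
      by apply: (measurableT_comp (fine_measurable measurableT)); exact: emajorant_Gmeasurable.
    exact.
  suff : forall m, (m <= n)%N ->
      measurable_fun (setT : set (g_sigma_algebraType (F n))) (majorant m) by exact.
  rewrite /majorant; elim => [|m IH] mn /=; first exact: mfine.
  by apply: measurable_maxr; [exact: IH (ltnW mn)|exact: mfine].
- move=> n x; apply: le_trans (fine_emajorant_le n x).
  by rewrite fine_ge0// emajorant_ge0.
- by move=> n x; rewrite /majorant /= le_max lexx.
Qed.

(** If [nu k >= n + 1], then [E i (a k)] vanishes for all [i <= n + 1] and so does its [N];
    otherwise [nu k <= n] and the term is already counted at time [n]. Subadditivity bounds the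
    partial sums and [mf_closed] passes to their limit. *)
Lemma ae_le_majorant n : {ae P, forall x, N n.+1 (f^~ x) <= majorant n x}.
Proof.
have A1 := emajorant_ae_fin n.
have A2 := ae_foralln cv.
have A3 : {ae P, forall x k i, nu_ge (nu k) i x -> E i (a k) x = 0}.
  by apply: ae_forall_int => k; apply: ae_foralln => i; case: (at_a k).
have A4 : {ae P, forall x k, Bnu (nu k) x -> (Top (fun n => E n (a k)) x <= w k)%E}.
  by apply: ae_forall_int => k; case: (at_a k).
apply: filterS2 (filterS2 _ _ A1 A2) (filterS2 _ _ A3 A4); last 2 first.
- by move=> x h1 h2; exact: (conj h1 h2).
- by move=> x h1 h2; exact: (conj h1 h2).
move=> x [Lfin cvx] [zero bound].
apply: le_trans (fine_emajorant_le n x).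
apply: (mf_closed HN) => [i|m]; first exact: cvx.
rewrite -lee_fin fineK ?ge0_fin_numE ?emajorant_ge0//.
apply: le_trans (nneseries_pair_partial m (fun k => majorant_term_ge0 n k x)).
have tle k : ((mu k * N n.+1 (fun i => E i (a k) x))%:E <= majorant_term n k x)%E.
  have [ge|nge] := boolP (nu_ge (nu k) n.+1 x).
    rewrite (mf_local HN (v := fun=> 0)) ?mf_cst0// ?mulr0 ?majorant_term_ge0// => i iN.
    apply: zero; move: ge; rewrite /nu_ge; case: (nu k x) => // p; exact: leq_trans.
  rewrite /majorant_term indicE mem_set// mulr1 EFinM lee_wpmul2l ?lee_fin//.
  have /bound /(HTop (fun n => E n (a k)) x (w k)) : Bnu (nu k) x.
    by move: nge; rewrite /nu_ge /Bnu /=; case: (nu k x).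
  by apply.
elim: m => [|m IH].
  by rewrite (mf_local HN (v := fun=> 0)) ?mf_cst0 ?big_geq// => i _; rewrite big_geq.
rewrite big_nat_recr//=.
rewrite (mf_local HN (v := fun i => \sum_(0 <= j < m)
       (mu (Posz j) * E i (a (Posz j)) x + mu (Negz j) * E i (a (Negz j)) x) +
     (mu (Posz m) * E i (a (Posz m)) x + mu (Negz m) * E i (a (Negz m)) x))); last first.
  by move=> i _; rewrite big_nat_recr.
apply: le_trans (leeD IH (leeD (tle (Posz m)) (tle (Negz m)))).
rewrite -!EFinD lee_fin (le_trans (mf_add HN _ _ _))// lerD2l.
by rewrite (le_trans (mf_add HN _ _ _))// !(mf_scale HN) !ger0_norm.
Qed.

Lemma majorant_norm_le_at_fun :
  (majorant_norm N P F phi f <= lux_norm P phi (at_fun P phi r mu nu))%E.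
Proof.
apply: (@le_trans _ _ (lux_norm P phi (linf majorant))).
  apply: ereal_inf_lbound; exists majorant => //; split; first exact: majorant_Lambda.
  by case=> // n _; exact: ae_le_majorant.
rewrite -[leRHS]mul1e; apply: lux_norm_le_scale => // x.
  apply: le_trans (ereal_sup_ubound _); last by exists 0%N.
  by rewrite lee_fin; case: majorant_Lambda => _ + _; exact.
rewrite mul1e; apply: ge_ereal_sup => _ [n _ <-].
exact: le_trans (majorant_le_emajorant n x) (emajorant_le_at_fun n x).
Qed.

End atomic_to_majorant.

Lemma majorant_norm_le_at_norm {R : realType} {d : measure_display}
    {T : measurableType d} (P : probability T R) (F : nat -> set (set T))
    (E : nat -> (T -> R) -> T -> R) (phi : T -> R -> R)
    (N : nat -> (nat -> R) -> R) (Top : (nat -> T -> R) -> T -> \bar R)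
    (r : R) (f : nat -> T -> R) :
  filtration F -> MO_function phi -> maximal_functional N -> is_sup_of N Top ->
  0 < r <= 1 -> (majorant_norm N P F phi f <= at_norm P F E phi Top r f)%E.
Proof.
move=> HF MO HN HTop r01.
apply: le_ereal_inf_tmp => _ [mu [a [nu [mu0 at_a cv ->]]]].
have [fin|] := ltP (lux_norm P phi (at_fun P phi r mu nu)) +oo%E.
  exact: (majorant_norm_le_at_fun HF MO HN HTop r01 mu0 at_a cv fin).
by rewrite leye_eq => /eqP ->; exact: leey.
Qed.

(** * From majorants to atoms *)

Section first_passage.
Context {R : realType} {d : measure_display} {T : measurableType d}.
Implicit Types (l : nat -> T -> R) (t : R).

Definition first_passage l t (x : T) : option nat :=
  if pselect (exists n, t < l n x) is left e then Some (ex_minn e) else None.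

Lemma first_passage_Some l t x n : first_passage l t x = Some n ->
  t < l n x /\ forall m, (m < n)%N -> l m x <= t.
Proof.
rewrite /first_passage; case: pselect => // e [<-]; case: ex_minnP => m lm min.
by split => // j jm; rewrite leNgt; apply/negP => /min; rewrite leqNgt jm.
Qed.

Lemma first_passage_None l t x n : first_passage l t x = None -> l n x <= t.
Proof.
rewrite /first_passage; case: pselect => // e _; rewrite leNgt; apply/negP => h.
by apply: e; exists n.
Qed.

Lemma Bnu_first_passage l t : Bnu (first_passage l t) = [set x | exists n, t < l n x].
Proof.
apply/seteqP; split => x; rewrite /Bnu /=.
  by case e : (first_passage l t x) => [n|//] _; exists n; have [] := first_passage_Some e.
by move=> [n h] /(first_passage_None n); rewrite leNgt h.
Qed.

Lemma nu_ge_first_passage l t n m x :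
  nu_ge (first_passage l t) n x -> (m < n)%N -> l m x <= t.
Proof.
rewrite /nu_ge; case e : (first_passage l t x) => [p|] np mn.
  by have [_] := first_passage_Some e; apply; exact: leq_trans np.
exact: first_passage_None e.
Qed.

End first_passage.

Section majorant_to_atomic.
Context {R : realType} {d : measure_display} {T : measurableType d}
  (P : probability T R) (F : nat -> set (set T)) (HF : filtration F)
  (E : nat -> (T -> R) -> T -> R) (HE : condexps P F E)
  (phi : T -> R -> R) (MO : MO_function phi)
  (N : nat -> (nat -> R) -> R) (HN : maximal_functional N)
  (Top : (nat -> T -> R) -> T -> \bar R) (HTop : is_sup_of N Top).

Let sF n : sigma_algebra setT (F n). Proof. by case: HF. Qed.
Let Fm n : F n `<=` measurable. Proof. by case: HF. Qed.
Let Fle m n : (m <= n)%N -> F m `<=` F n.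
Proof. by apply: filtration_le; case: HF. Qed.

(** [E n] is known only through the defining property of conditional expectation, so homogeneity is
    obtained from almost everywhere uniqueness. *)
Lemma condexp_scale n (b g : T -> R) (s : R) : P.-integrable setT (EFin \o b) ->
  Gmeasurable (F n) g -> P.-integrable setT (EFin \o g) ->
  (forall A, F n A -> (\int[P]_(x in A) (b x)%:E = \int[P]_(x in A) (g x)%:E)%E) ->
  {ae P, forall x, E n (fun x => s * b x) x = s * g x}.
Proof.
move=> ib mg ig bg.
have isb : P.-integrable setT (EFin \o (fun x => s * b x)).
  exact: (integrableZl measurableT s ib).
have isg : P.-integrable setT (EFin \o (fun x => s * g x)).
  exact: (integrableZl measurableT s ig).
have [mE iE intE] := HE n isb.
apply: (Gmeasurable_ae_eq (sF n) (@Fm n) mE _ iE isg).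
  apply/(GmeasurableP (sF n)); apply: measurable_funM; first exact: measurable_cst.
  exact/(GmeasurableP (sF n)).
move=> A FA; rewrite intE//; have mA := Fm FA.
have iA (h : T -> R) : P.-integrable setT (EFin \o h) -> P.-integrable A (EFin \o h).
  exact: integrableS.
under eq_integral do rewrite EFinM.
under [RHS]eq_integral do rewrite EFinM.
by rewrite !integralZl ?bg//; exact: iA.
Qed.

Context (f : nat -> T -> R) (Hf : martingale0 P F f)
  (l : nat -> T -> R) (Hl : Lambda F l)
  (fl : forall n, (0 < n)%N -> {ae P, forall x, N n (f^~ x) <= l n.-1 x}).

Let l_nd x : {homo l ^~ x : i j / (i <= j)%N >-> i <= j}.
Proof. by apply/nondecreasing_seqP => n; case: Hl. Qed.

(** The points at which all pathwise bounds apply simultaneously. *)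
Let good (x : T) : Prop :=
  f 0%N x = 0 /\ forall n, (0 < n)%N -> N n (f^~ x) <= l n.-1 x.

Let ae_good : {ae P, forall x, good x}.
Proof.
have [_ _ _ f0] := Hf.
have fl' : {ae P, forall x n, (0 < n)%N -> N n (f^~ x) <= l n.-1 x}.
  by apply: ae_foralln => n; case: n => [|n]; [exact: aeW|apply: filterS (fl (ltn0Sn n))].
by apply: filterS2 f0 fl' => x h1 h2; split.
Qed.

Let d_ (i : nat) (x : T) : R := f i.+1 x - f i x.

Let mf n : Gmeasurable (F n) (f n). Proof. by case: Hf. Qed.
Let if_ n : P.-integrable setT (EFin \o f n). Proof. by case: Hf. Qed.

Lemma martingale_incr_Gmeasurable i : Gmeasurable (F i.+1) (d_ i).
Proof.
apply/(GmeasurableP (sF i.+1)); apply: measurable_funB; apply/(GmeasurableP (sF i.+1)) => //.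
by move=> B mB; apply: (@Fle i i.+1) => //; exact: mf.
Qed.

Lemma integral_martingale_incr i A : F i A -> (\int[P]_(x in A) (d_ i x)%:E = 0)%E.
Proof.
move=> FA; have mA := Fm FA; have [_ _ mart _] := Hf.
have iA n : P.-integrable A (EFin \o f n) by exact: (integrableS _ _ _ (if_ n)).
under eq_integral do rewrite EFinB.
by rewrite integralB_EFin// mart// subee//; exact: (integrable_fin_num mA (iA i)).
Qed.

(** * The part of the martingale between the levels [t] and [2 * t] *)

Section layer.
Context (t : R) (t0 : 0 < t).

(* The clause [`|d_ i x| <= 4 * t] holds almost everywhere on the layer; it only
   makes [layer_incr] bounded everywhere. *)
Definition layer_set (i : nat) : set T :=
  [set x | t < l i x] `&` [set x | l i x <= 2 * t] `&` [set x | `|d_ i x| <= 4 * t].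

Definition layer_incr (i : nat) (x : T) : R := \1_(layer_set i) x * d_ i x.

Lemma layer_incr_Gmeasurable i : Gmeasurable (F i.+1) (layer_incr i).
Proof.
have md := martingale_incr_Gmeasurable i.
have ml : Gmeasurable (F i.+1) (l i).
  by move=> B mB; apply: (@Fle i i.+1) => //; case: Hl => + _ _; exact.
have FA : F i.+1 (layer_set i).
  have g1 : F i.+1 [set x | t < l i x] by exact: Gmeasurable_lt.
  have g2 : F i.+1 [set x | l i x <= 2 * t] by exact: Gmeasurable_le.
  have g3 : F i.+1 [set x | `|d_ i x| <= 4 * t].
    apply: (@Gmeasurable_le _ _ _ _ (fun x => `|d_ i x|)).
    by apply/(GmeasurableP (sF i.+1)); apply: measurableT_comp => //;
      exact/(GmeasurableP (sF i.+1)).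
  rewrite /layer_set; move: g1 g2 g3; rewrite (sub_measurableE (sF i.+1)) => g1 g2 g3.
  by apply: measurableI => //; exact: measurableI.
apply/(GmeasurableP (sF i.+1)); apply: measurable_funM; apply/(GmeasurableP (sF i.+1)) => //.
exact: Gmeasurable_indic.
Qed.

Lemma layer_incr_le i x : `|layer_incr i x| <= 4 * t.
Proof.
rewrite /layer_incr indicE; have [/set_mem[_ //]|_] := boolP (x \in _).
  by rewrite mul1r.
by rewrite mul0r normr0 mulr_ge0// ltW.
Qed.

(** On a good path [incr_le] gives [|d_ i x| <= 2 * l i x <= 4 * t] on the layer, so the third
    clause of [layer_set] holds automatically. *)
Lemma layer_incrE x i : good x -> layer_incr i x =
  (if l i x <= 2 * t then d_ i x else 0) - (if l i x <= t then d_ i x else 0).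
Proof.
move=> [f0 fN]; rewrite /layer_incr indicE.
have [lt|lt] := leP (l i x) t.
  rewrite ifT ?subrr; last by move: lt t0; lra.
  by rewrite memNset ?mul0r// => -[[/=]]; rewrite ltNge lt.
rewrite subr0; case: ifPn => l2t; last first.
  by rewrite memNset ?mul0r// => -[[_ /=]]; rewrite (negPf l2t).
rewrite mem_set ?mul1r//; split => //=.
have := incr_le HN (l_nd x) f0 fN i; rewrite /d_; move: l2t; lra.
Qed.

(** The clause on [d_ i] is only known at time [i + 1]. It is dropped almost everywhere, leaving the
    set [S] of [F i], over which the martingale increment integrates to 0. *)
Lemma integral_layer_incr i A : F i A -> (\int[P]_(x in A) (layer_incr i x)%:E = 0)%E.
Proof.
move=> FA; have mA := Fm FA.
pose S := [set x | t < l i x] `&` [set x | l i x <= 2 * t].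
have ml : Gmeasurable (F i) (l i) by case: Hl => + _ _; exact.
have FS : F i S.
  have g1 : F i [set x | t < l i x] by exact: Gmeasurable_lt.
  have g2 : F i [set x | l i x <= 2 * t] by exact: Gmeasurable_le.
  rewrite /S; move: g1 g2; rewrite (sub_measurableE (sF i)) => g1 g2.
  exact: measurableI.
have mS := Fm FS.
have mli := Gmeasurable_measurable (@Fm _) (layer_incr_Gmeasurable i).
have md := Gmeasurable_measurable (@Fm _) (martingale_incr_Gmeasurable i).
transitivity (\int[P]_(x in A) (((EFin \o d_ i) \_ S) x))%E; last first.
  rewrite -integral_mkcondr integral_martingale_incr//.
  by move: FA FS; rewrite (sub_measurableE (sF i)) => g1 g2; exact: measurableI.
apply: ae_eq_integral => //.
- by apply/measurable_EFinP; exact: measurable_funTS.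
- apply: measurable_funTS; apply/(measurable_restrictT _ mS).
  by apply/measurable_EFinP; exact: measurable_funTS.
apply: filterS ae_good => x gx _; rewrite /= layer_incrE// patchE.
have [lt|lt] := leP (l i x) t.
  rewrite ifT ?subrr; last by move: lt t0; lra.
  by rewrite memNset// => -[/=]; rewrite ltNge lt.
rewrite subr0; case: ifPn => l2t; last first.
  by rewrite memNset// => -[_ /=]; rewrite (negPf l2t).
by rewrite mem_set.
Qed.

Lemma psum_layerE x n : good x -> psum layer_incr n x =
  stopped_at (2 * t) (f^~ x) (l^~ x) n - stopped_at t (f^~ x) (l^~ x) n.
Proof.
move=> gx; rewrite !stopped_at_big0 -sumrB; apply: eq_bigr => i _.
by rewrite layer_incrE.
Qed.

Lemma mf_psum_layer_le x n : good x ->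
  N n (fun i => psum layer_incr i x) <= 3 * t.
Proof.
move=> gx; have [f0 fN] := gx.
rewrite (mf_local HN (v := fun i => stopped_at (2 * t) (f^~ x) (l^~ x) i +
    - stopped_at t (f^~ x) (l^~ x) i)); last by move=> i _; exact: psum_layerE.
rewrite (le_trans (mf_add HN _ _ _))// mf_opp//.
have s2 : N n (stopped_at (2 * t) (f^~ x) (l^~ x)) <= 2 * t.
  by apply: (mf_stopped_le HN (l_nd x) f0 fN); rewrite mulr_ge0// ltW.
have s1 : N n (stopped_at t (f^~ x) (l^~ x)) <= t.
  by apply: (mf_stopped_le HN (l_nd x) f0 fN); exact: ltW.
lra.
Qed.

(** For [S] the bound holds at almost every point before integration; for [M] the sum of integrals
    is first rewritten as the integral of the squared terminal value. The constants [b] only secure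
    integrability. *)
Lemma layer_energy_le n :
  \sum_(0 <= i < n) \int[P]_x (layer_incr i x ^+ 2) <= (3 * t) ^+ 2.
Proof.
have ms i : measurable_fun setT (layer_incr i).
  exact: Gmeasurable_measurable (@Fm _) (layer_incr_Gmeasurable i).
have is2 i := sqr_integrable P (ms i) (layer_incr_le i).
have K0 : 0 <= 3 * t by rewrite mulr_ge0// ltW.
have [SN|absN] := mf_energy HN.
  rewrite -Rintegral_sum//; apply: (Rintegral_ae_le (b := n%:R * (4 * t) ^+ 2)).
  - by apply: measurable_sum => i; exact: measurable_funX.
  - by move=> x; apply: sumr_ge0 => i _; exact: sqr_ge0.
  - move=> x; rewrite (le_trans (ler_norm_sum _ _ _))//.
    have le4 i : true -> `|layer_incr i x ^+ 2| <= (4 * t) ^+ 2.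
      move=> _; rewrite normrX ler_sqr ?nnegrE ?layer_incr_le//.
      by rewrite mulr_ge0// ltW.
    rewrite (le_trans (ler_sum _ le4))//.
    by rewrite sumr_const_nat subn0 -[leLHS]mulr_natl.
  apply: filterS ae_good => x gx.
  have S0 : 0 <= \sum_(0 <= i < n) layer_incr i x ^+ 2.
    by apply: sumr_ge0 => i _; exact: sqr_ge0.
  have : Sseq n (fun i => psum layer_incr i x) <= 3 * t.
    exact: le_trans (SN _ _) (mf_psum_layer_le n gx).
  rewrite /Sseq big_add1/= (eq_bigr (fun i => layer_incr i x ^+ 2)); last first.
    by move=> i _; rewrite /psum big_nat_recr//= [_ + layer_incr i x]addrC addrK.
  by rewrite -(ler_pXn2r (_ : 0 < 2)%N)// ?nnegrE ?sqrtr_ge0// sqr_sqrtr.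
rewrite -(energy_identity HF layer_incr_Gmeasurable layer_incr_le integral_layer_incr)//.
have mp : measurable_fun setT (psum layer_incr n).
  exact: (psum_measurable HF layer_incr_Gmeasurable).
have p0 x : psum layer_incr 0 x = 0 by rewrite /psum big_geq.
under eq_Rintegral do rewrite p0 subr0.
apply: (Rintegral_ae_le (b := (n%:R * (4 * t)) ^+ 2)).
- exact: measurable_funX.
- by move=> x; exact: sqr_ge0.
- move=> x; have p4 := psum_le layer_incr_le n x.
  have n4 : 0 <= n%:R * (4 * t) by rewrite !mulr_ge0// ltW.
  by rewrite normrX ler_sqr ?nnegrE.
apply: filterS ae_good => x gx.
have : `|psum layer_incr n x| <= 3 * t.
  exact: le_trans (absN n (fun i => psum layer_incr i x)) (mf_psum_layer_le n gx).
by rewrite -(ler_pXn2r (_ : 0 < 2)%N)// ?nnegrE// real_normK ?num_real.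
Qed.

Lemma exists_layer_closure : exists b : T -> R, P.-integrable setT (EFin \o b) /\
  forall n s, {ae P, forall x, E n (fun x => s * b x) x = s * psum layer_incr n x}.
Proof.
have [b [ib bE]] := square_integrable_martingale_closed HF layer_incr_Gmeasurable
  layer_incr_le integral_layer_incr layer_energy_le.
exists b; split => // n s; apply: condexp_scale => //.
- exact: (psum_Gmeasurable HF layer_incr_Gmeasurable).
- exact: (psum_integrable P HF layer_incr_Gmeasurable layer_incr_le).
- exact: bE.
Qed.

End layer.

(** * Assembling the dyadic layers into an atomic decomposition *)

Let t (k : int) : R := 2 ^ k.

Let t0 k : 0 < t k. Proof. exact: exprz_gt0. Qed.

Let tS k : t (k + 1) = 2 * t k.
Proof. by rewrite /t expfzDr// expr1z mulrC. Qed.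

Let nu (k : int) : T -> option nat := first_passage l (t k).

Lemma first_passage_stopping k : stopping_time F (nu k).
Proof.
have g1 n : F n [set x | t k < l n x].
  by apply: Gmeasurable_lt; case: Hl => + _ _; exact.
have g2 n m : (m <= n)%N -> F n [set x | l m x <= t k].
  by move=> mn; apply: (Fle mn); apply: Gmeasurable_le; case: Hl => + _ _; exact.
have E1 x n : nu k x = Some n <-> t k < l n x /\ forall m, (m < n)%N -> l m x <= t k.
  split; first exact: first_passage_Some.
  move=> [tn mn]; case e : (nu k x) => [p|]; last first.
    by have := first_passage_None n e; rewrite leNgt tn.
  have [tp mp] := first_passage_Some e; congr Some.
  have [pn|np|//] := ltngtP p n.
    by have := mn _ pn; rewrite leNgt tp.
  by have := mp _ np; rewrite leNgt tn.
case=> [|n].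
  rewrite (_ : [set x | _] = [set x | t k < l 0%N x]); first exact: g1.
  by apply/seteqP; split => x /=; rewrite E1 => // -[].
rewrite (_ : [set x | _] = [set x | t k < l n.+1 x] `&` [set x | l n x <= t k]).
  have := g1 n.+1; have := g2 n.+1 n (leqnSn n).
  by rewrite (sub_measurableE (sF n.+1)) => h1 h2; exact: measurableI.
apply/seteqP; split => x /=; rewrite E1; first by move=> [h1 h2]; split => //; exact: h2.
move=> [h1 h2]; split => // m mn; apply: le_trans h2; exact: l_nd.
Qed.

Lemma Bnu_first_passage_measurable k : measurable (Bnu (nu k)).
Proof.
rewrite Bnu_first_passage (_ : [set x | _] = \bigcup_n [set x | t k < l n x]).
  apply: bigcup_measurable => n _; apply: (@Fm n).
  by apply: Gmeasurable_lt; case: Hl => + _ _; exact.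
by apply/seteqP; split => x /=; [move=> [n h]; exists n|move=> [n _ h]; exists n].
Qed.

Let l_le_linf n x : ((l n x)%:E <= linf l x)%E.
Proof. by apply: ereal_sup_ubound; exists n. Qed.

Let linf_ge0 x : (0 <= linf l x)%E.
Proof. by apply: le_trans (l_le_linf 0 x); rewrite lee_fin; case: Hl. Qed.

Lemma Bnu_lt_linf k x : Bnu (nu k) x -> ((t k)%:E < linf l x)%E.
Proof.
by rewrite Bnu_first_passage => -[n h]; apply: lt_le_trans (l_le_linf n x); rewrite lte_fin.
Qed.

Context (fin : (lux_norm P phi (linf l) < +oo)%E).

Let w (k : int) : R := fine (lux_norm P phi (EFin \o \1_(Bnu (nu k)))).

(** Finite because [2 ^ k] times the indicator of [Bnu (nu k)] is at most [linf l]. *)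
Lemma lux_norm_BnuE k : lux_norm P phi (EFin \o \1_(Bnu (nu k))) = (w k)%:E.
Proof.
rewrite /w fineK// ge0_fin_numE ?lux_norm_ge0//.
apply: (@le_lt_trans _ _ (((t k)^-1)%:E * lux_norm P phi (linf l))%E); last first.
  by rewrite lte_mul_pinfty// lee_fin invr_ge0 ltW.
apply: lux_norm_le_scale => // [|x|x]; first by rewrite invr_gt0.
  by rewrite lee_fin indicE.
rewrite lee_pdivlMl//= indicE; have [/set_mem xB|_] := boolP (x \in _).
  by rewrite mule1 ltW// Bnu_lt_linf.
by rewrite mule0.
Qed.

Let w0 k : 0 <= w k.
Proof. by rewrite -lee_fin -lux_norm_BnuE lux_norm_ge0. Qed.

(** Dividing a layer, whose [N] is at most [3 * t k], by this coefficient gives exactly the bound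
    [1 / w k] required of an atom. *)
Let mu (k : int) : R := 3 * t k * w k.

Let mu0 k : 0 <= mu k.
Proof. by rewrite !mulr_ge0// ltW. Qed.

Lemma at_fun_le_linf r x : 0 < r ->
  (at_fun P phi r mu nu x <= (atomic_constant r)%:E * linf l x)%E.
Proof.
move=> r0; have C0 := atomic_constant_gt0 r0.
case e : (linf l x) => [L| |]; last 2 first.
- by rewrite gt0_muley ?leey.
- by have := linf_ge0 x; rewrite e.
have L0 : 0 <= L by rewrite -lee_fin -e linf_ge0.
have q0 := one_sub_powR_gt0 r0.
pose term k := poweR ((mu k * \1_(Bnu (nu k)) x)%:E *
  (lux_norm P phi (EFin \o \1_(Bnu (nu k))))^-1)%E r.
have term0 k : (0 <= term k)%E by exact: poweR_ge0.
have termle k : (term k <= (3 `^ r * dyadic_layer r L k)%:E)%E.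
  have d0 : (0 <= (3 `^ r * dyadic_layer r L k)%:E)%E.
    by rewrite lee_fin mulr_ge0 ?powR_ge0// /dyadic_layer; case: ifP => // _; exact: powR_ge0.
  rewrite /term lux_norm_BnuE indicE; have [/set_mem xB|_] := boolP (x \in _); last first.
    by rewrite mulr0 mul0e poweR0r// gt_eqF.
  (* Here [mu k = 0] meets an infinite inverse norm, and the product is 0 by convention. *)
  have [wz|wn0] := eqVneq (w k) 0.
    by rewrite /mu wz mulr0 mul0r mul0e poweR0r// gt_eqF.
  rewrite inver (negPf wn0) -EFinM poweR_EFin lee_fin mulr1 /mu mulfK//.
  have xL : 2 ^ k < L by rewrite -lte_fin -e; exact: Bnu_lt_linf.
  by rewrite powRM ?(ltW (t0 k))// /dyadic_layer xL.
have sumle : (\sum_(0 <= i <oo) (term (Posz i) + term (Negz i)) <=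
    (3 `^ r * (L `^ r * (1 - 2 `^ (- r))^-1))%:E)%E.
  apply: lime_le; first by apply: is_cvg_nneseries => i _ _; exact: adde_ge0.
  apply: nearW => n.
  apply: (@le_trans _ _ (\sum_(0 <= i < n) (3 `^ r * dyadic_layer r L (Posz i) +
      3 `^ r * dyadic_layer r L (Negz i))%:E)%E).
    by apply: lee_sum => i _; rewrite EFinD leeD.
  rewrite sumEFin lee_fin; under eq_bigr do rewrite -mulrDr.
  by rewrite -mulr_sumr ler_wpM2l ?powR_ge0// dyadic_sum_le.
apply: (@le_trans _ _ (poweR (3 `^ r * (L `^ r * (1 - 2 `^ (- r))^-1))%:E r^-1)).
  apply: gt0_ler_poweR; rewrite ?invr_ge0 ?in_itv/= ?leey ?andbT//.
  - exact: ltW.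
  - by apply: nneseries_ge0 => i _ _; apply: adde_ge0; exact: poweR_ge0.
  - by rewrite lee_fin !mulr_ge0 ?powR_ge0// invr_ge0 ltW.
have qi0 : 0 <= (1 - 2 `^ (- r))^-1 :> R by rewrite invr_ge0 ltW.
have rr : r * r^-1 = 1 by rewrite mulfV// gt_eqF.
rewrite poweR_EFin -EFinM lee_fin !powRM ?mulr_ge0 ?powR_ge0//.
by rewrite -!powRrM rr !powRr1// /atomic_constant mulrA mulrAC.
Qed.

Lemma at_norm_le_linf r : 0 < r ->
  (at_norm P F E phi Top r f <= (atomic_constant r)%:E * lux_norm P phi (linf l))%E.
Proof.
move=> r0; apply: (@le_trans _ _ (lux_norm P phi (at_fun P phi r mu nu))); last first.
  apply: lux_norm_le_scale => // [|x|x]; first exact: atomic_constant_gt0.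
    exact: poweR_ge0.
  exact: at_fun_le_linf.
have /choice[b Hb] : forall k, exists b : T -> R, P.-integrable setT (EFin \o b) /\
    forall n s, {ae P, forall x, E n (fun x => s * b x) x = s * psum (layer_incr (t k)) n x}.
  by move=> k; exact: exists_layer_closure.
(* If [w k = 0] then [mu k = 0] and [a k = 0]; this is harmless because
   [Bnu (nu k)] is then negligible. *)
pose a k x := (mu k)^-1 * b k x.
have aeE : {ae P, forall x k n, E n (a k) x = (mu k)^-1 * psum (layer_incr (t k)) n x}.
  apply: ae_forall_int => k; apply: ae_foralln => n.
  by have [_ /(_ n (mu k)^-1)] := Hb k.
have aeB : {ae P, forall x k, w k = 0 -> ~ Bnu (nu k) x}.
  apply: ae_forall_int => k; have [wz|wn0] := eqVneq (w k) 0; last first.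
    by apply/aeW => x wz; move: wn0; rewrite wz eqxx.
  have mB := Bnu_first_passage_measurable k.
  have B0 : P (Bnu (nu k)) = 0%E.
    by apply: (lux_norm_indic_eq0 MO mB); rewrite lux_norm_BnuE wz.
  exists (Bnu (nu k)); split => // x /= h; apply: contrapT => nB; exact: h.
have psum0 k n x : nu_ge (nu k) n x -> psum (layer_incr (t k)) n x = 0.
  move=> ge; rewrite /psum big1_seq// => i; rewrite mem_index_iota => /andP[_ /andP[_ iN]].
  rewrite /layer_incr indicE memNset ?mul0r// => -[[/= lt _] _].
  by have := nu_ge_first_passage ge iN; rewrite leNgt lt.
apply: ereal_inf_lbound; exists mu, a, nu; split => //.
- move=> k; split.
  + by have [ib _] := Hb k; exact: (integrableZl measurableT (mu k)^-1 ib).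
  + exact: first_passage_stopping.
  + by move=> n; apply: filterS aeE => x Ex ge; rewrite Ex psum0 ?mulr0.
  + apply: filterS2 (filterS2 _ _ aeE aeB) ae_good; last first.
      by move=> x h1 h2; exact: (conj h1 h2).
    move=> x [Ex nB] gx xB.
    have wn0 : w k != 0 by apply/eqP => /nB; exact.
    have wgt : 0 < w k by rewrite lt_neqAle eq_sym wn0 w0.
    rewrite lux_norm_BnuE inver (negPf wn0).
    apply/(HTop (fun n => E n (a k)) x) => n; rewrite lee_fin.
    rewrite (mf_local HN (v := fun i => (mu k)^-1 * psum (layer_incr (t k)) i x)) => [|i _].
      have mugt : 0 < mu k by rewrite !mulr_gt0.
      rewrite (mf_scale HN) ger0_norm ?invr_ge0// ler_pdivrMl// /mu mulfK//.
      exact: mf_psum_layer_le.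
    exact: Ex.
- move=> n; apply: filterS2 (filterS2 _ _ aeE aeB) ae_good; last first.
    by move=> x h1 h2; exact: (conj h1 h2).
  move=> x [Ex nB] gx; have [f0 fN] := gx.
  pose S k := stopped_at (t k) (f^~ x) (l^~ x) n.
  have muE k : mu k * E n (a k) x = S (k + 1) - S k.
    rewrite Ex /S tS -psum_layerE//.
    (* When [w k = 0] the point lies outside [Bnu (nu k)], so the level is never passed and the
       layer is 0, like [mu k]. *)
    have [wz|wn0] := eqVneq (w k) 0.
      rewrite /mu wz mulr0 mul0r psum0// /nu_ge.
      by case e : (nu k x) => [m|//]; exfalso; apply: (nB k wz); rewrite /Bnu /= e.
    rewrite mulrA mulfV ?mul1r// gt_eqF// !mulr_gt0//.
    by rewrite lt_neqAle eq_sym wn0 w0.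
  rewrite /seq_cvg_to; under eq_fun do under eq_bigr do rewrite !muE.
  under eq_fun do rewrite telescope_int.
  (* The upper end equals [f n x] once [2 ^ M >= l n x]; the lower end is at most
     [2 * n * 2 ^ (-M)]. *)
  rewrite -[f n x]subr0; apply: cvgB.
    apply: cvg_near_cst.
    exists (Num.bound `|l n x|) => // M /= lM.
    apply: (stopped_at_large (l_nd x) f0).
    rewrite (le_trans (ler_norm _))// ltW// (lt_le_trans (archi_boundP (normr_ge0 _)))//.
    rewrite /t -exprnP (le_trans (_ : _ <= M%:R))// ?ler_nat//.
    by rewrite -natrX ler_nat ltnW// ltn_expl.
  apply/cvgr0Pnorm_le => e e0.
  have half : `|2^-1 : R| < 1 by rewrite ger0_norm ?invr_ge0// invf_lt1//; lra.
  have z : (fun M : nat => (2 * n%:R) * (2^-1 : R) ^+ M) @ \oo --> (0 : R).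
    by rewrite -[X in _ --> X](mulr0 (2 * n%:R)); apply: cvgMl_tmp; exact: cvg_expr.
  apply: filterS (cvgr0_norm_le _ z _ e0) => M; apply: le_trans.
  rewrite [leRHS]ger0_norm ?mulr_ge0 ?exprn_ge0 ?invr_ge0//.
  have := stopped_at_le HN (l_nd x) f0 fN n (ltW (t0 (- M%:Z))).
  by rewrite /S /t -exprnN exprVn mulrAC.
Qed.

End majorant_to_atomic.

Lemma at_norm_le_majorant_norm {R : realType} {d : measure_display}
    {T : measurableType d} (P : probability T R) (F : nat -> set (set T))
    (E : nat -> (T -> R) -> T -> R) (phi : T -> R -> R)
    (N : nat -> (nat -> R) -> R) (Top : (nat -> T -> R) -> T -> \bar R)
    (r : R) (f : nat -> T -> R) :
  filtration F -> condexps P F E -> MO_function phi -> maximal_functional N ->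
  is_sup_of N Top -> 0 < r -> martingale0 P F f ->
  (at_norm P F E phi Top r f <=
    (atomic_constant r)%:E * majorant_norm N P F phi f)%E.
Proof.
move=> HF HE MO HN HTop r0 Hf.
apply: le_mul_ereal_inf; first exact: atomic_constant_gt0.
move=> _ [l [Hl fl] <-]; have [fin|] := ltP (lux_norm P phi (linf l)) +oo%E.
  exact: (at_norm_le_linf HF HE MO HN HTop Hf Hl fl fin r0).
rewrite leye_eq => /eqP ->; rewrite gt0_muley ?leey// lte_fin.
exact: atomic_constant_gt0.
Qed.

Theorem theorem4p4 (R : realType) (d : measure_display) (T : measurableType d)
    (P : probability T R) (F : nat -> set (set T))
    (E : nat -> (T -> R) -> T -> R) (phi : T -> R -> R) :
  filtration F -> condexps P F E -> MO_function phi ->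
  forall r : R, 0 < r <= 1 ->
  exists C : R, 0 < C /\
    forall f : nat -> T -> R, martingale0 P F f ->
      [/\ (P_norm P F phi f <= C%:E * at_norm P F E phi Mx r f)%E,
          (at_norm P F E phi Mx r f <= C%:E * P_norm P F phi f)%E,
          (Q_norm P F phi f <= C%:E * at_norm P F E phi Sq r f)%E &
          (at_norm P F E phi Sq r f <= C%:E * Q_norm P F phi f)%E].
Proof.
move=> HF HE MO r r01; have /andP[r0 _] := r01.
(* One constant for all four bounds: it dominates both 1, for atoms to majorants, and
   [atomic_constant r], for the converse. *)
exists (1 + atomic_constant r); have C0 := atomic_constant_gt0 r0.
split; first by lra.
move=> f Hf.
have scale_le (s : R) (x y : \bar R) : (0 <= y)%E -> 0 <= s -> s <= 1 + atomic_constant r ->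
    (x <= s%:E * y)%E -> (x <= (1 + atomic_constant r)%:E * y)%E.
  by move=> y0 s0 sC /le_trans; apply; rewrite lee_wpmul2r// lee_fin.
have at0 Top : (0 <= at_norm P F E phi Top r f)%E.
  by apply: le_ereal_inf_tmp => _ [? [? [? [_ _ _ ->]]]]; exact: lux_norm_ge0.
have maj0 N : (0 <= majorant_norm N P F phi f)%E.
  by apply: le_ereal_inf_tmp => _ [? _ <-]; exact: lux_norm_ge0.
have half1 N Top : maximal_functional N -> is_sup_of N Top ->
    (majorant_norm N P F phi f <= (1 + atomic_constant r)%:E * at_norm P F E phi Top r f)%E.
  move=> HN HTop; apply: (scale_le 1) => //; first by lra.
  by rewrite mul1e; exact: majorant_norm_le_at_norm.
have half2 N Top : maximal_functional N -> is_sup_of N Top ->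
    (at_norm P F E phi Top r f <= (1 + atomic_constant r)%:E * majorant_norm N P F phi f)%E.
  move=> HN HTop; apply: (scale_le (atomic_constant r)) => //; [exact: ltW|lra|].
  exact: at_norm_le_majorant_norm.
split.
- exact: (half1 _ _ Mseq_maximal Mx_is_sup).
- exact: (half2 _ _ Mseq_maximal Mx_is_sup).
- exact: (half1 _ _ Sseq_maximal Sq_is_sup).
- exact: (half2 _ _ Sseq_maximal Sq_is_sup).
Qed.
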